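(* Let $g=\{\lambda_\delta\}$ be an invariant metric and $J=\{\varepsilon_\delta\}$ an invariant almost complex structure on the flag manifold $\mathbb F_\Theta$. The pair $(g,J)$ is a $\mathcal G_1$ structure on $\mathbb F_\Theta$ if and only if $\lambda_\delta=\lambda_\zeta=\lambda_\eta$ for every $(0,3)$-triple of t-roots $\{\delta,\zeta,\eta\}$.
   Context: Flag manifolds and t-roots. $\mathfrak g$ is a finite-dimensional complex semisimple Lie algebra, $\mathfrak h$ a Cartan subalgebra, $R$ the root system, $B$ the Killing form, $H_\alpha\in\mathfrak h$ the element with $\alpha(X)=B(X,H_\alpha)$, $\mathfrak h_{\mathbb R}$ the real span of the $H_\alpha$, $\Sigma$ a simple system, $R^\pm$ the positive/negative roots. For $\Theta\subset\Sigma$: $R_\Theta=\langle\Theta\rangle\cap R$, $R_\Theta^{\pm}=R_\Theta\cap R^{\pm}$, $R_M=R\setminus R_\Theta$, $R_M^+=R_M\cap R^+$. $G$ is a Lie group with Lie algebra $\mathfrak g$, $P_\Theta$ the normalizer in $G$ of $\mathfrak p_\Theta=\mathfrak h\oplus\sum_{\alpha\in R^+}\mathfrak g_\alpha\oplus\sum_{\alpha\in R_\Theta^-}\mathfrak g_\alpha$, and $\mathbb F_\Theta=G/P_\Theta$. Fix a Weyl basis $X_\alpha\in\mathfrak g_\alpha$ ($B(X_\alpha,X_{-\alpha})=1$, $[X_\alpha,X_\beta]=n_{\alpha,\beta}X_{\alpha+\beta}$ with $n_{\alpha,\beta}$ real and nonzero iff $\alpha+\beta\in R$, $n_{\alpha,\beta}=-n_{-\alpha,-\beta}$).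 Put $\mathfrak u_\alpha=\mathrm{span}_{\mathbb R}\{X_\alpha-X_{-\alpha},\,i(X_\alpha+X_{-\alpha})\}$, $\mathfrak u=i\mathfrak h_{\mathbb R}\oplus\sum_{\alpha\in R^+}\mathfrak u_\alpha$ (a compact real form), $U\subset G$ the corresponding compact group, $K_\Theta=P_\Theta\cap U$, with Lie algebra $\mathfrak k_\Theta=i\mathfrak h_{\mathbb R}\oplus\sum_{\alpha\in R_\Theta^+}\mathfrak u_\alpha$. Then $\mathbb F_\Theta=U/K_\Theta$ with tangent space at the origin $\mathfrak m=\sum_{\alpha\in R_M^+}\mathfrak u_\alpha$. Put $\mathfrak t=\{H\in i\mathfrak h_{\mathbb R}:\alpha(H)=0\ \forall\alpha\in R_\Theta\}$, $k(\alpha)=\alpha|_{\mathfrak t}$; the t-roots are $R_t=k(R_M)$ and $R_t^+=k(R_M^+)$. One has $\mathfrak m=\bigoplus_{\xi\in R_t^+}\mathfrak m_\xi$ with $\mathfrak m_\xi=\sum_{\alpha\in R_M^+,\,k(\alpha)=\xi}\mathfrak u_\alpha$, irreducible pairwise inequivalent $\mathrm{ad}(\mathfrak k_\Theta)$-modules. Invariant almost complex structures. These are the linear maps $J:\mathfrak m\to\mathfrak m$ with $J^2=-\mathrm{Id}$ commuting with $\mathrm{ad}(L)$ for all $L\in\mathfrak k_\Theta$. Each is given by signs $\varepsilon_\delta=\pm1$, $\delta\in R_t$, with $\varepsilon_{-\delta}=-\varepsilon_\delta$, via $JX_\alpha=i\varepsilon_{k(\alpha)}X_\alpha$ for $\alpha\in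 R_M$ (complex-linear extension to $\mathfrak m^{\mathbb C}$); write $J=\{\varepsilon_\delta\}$. Invariant metrics. These are the $\mathrm{ad}(\mathfrak k_\Theta)$-invariant inner products on $\mathfrak m$; they are exactly $g=-\sum_{\xi\in R_t^+}\lambda_\xi B|_{\mathfrak m_\xi\times\mathfrak m_\xi}$ with $\lambda_\xi>0$. Set $\lambda_{-\xi}=\lambda_\xi$ and write $g=\{\lambda_\delta\}$. $\mathcal G_1$ structures. $(g,J)$ is a $\mathcal G_1$ structure if $g(N(X,Y),X)=0$ for all $X,Y\in\mathfrak m$, where $N$ is the Nijenhuis tensor, $-\tfrac12N(X,Y)=-[JX,JY]+[X,Y]+J[X,JY]+J[JX,Y]$ for $X,Y\in\mathfrak m$ (brackets projected to $\mathfrak m$). Triples. A zero-sum triple of t-roots is $\{\delta,\zeta,\eta\}\subset R_t$ with $\delta+\zeta+\eta=0$ (entries not necessarily distinct). It is a $(0,3)$-triple (for $J$) if $\varepsilon_\delta=\varepsilon_\zeta=\varepsilon_\eta$, and a $(1,2)$-triple otherwise. *)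

(* Defs.v *)
From HB Require Import structures.
From mathcomp Require Import all_boot all_order all_algebra.
From mathcomp Require Import complex.
From mathcomp Require Import reals.

Set Implicit Arguments.
Unset Strict Implicit.
Unset Printing Implicit Defensive.

Import Order.TTheory GRing.Theory Num.Theory.
Local Open Scope ring_scope.

HB.mixin Record isLie (K : fieldType) L of Vector K L := {
  lie : L -> L -> L;
  lie_linearl : forall (a : K) (x y z : L),
    lie (a *: x + y) z = a *: lie x z + lie y z;
  lie_linearr : forall (a : K) (x y z : L),
    lie z (a *: x + y) = a *: lie z x + lie z y;
  liexx : forall x : L, lie x x = 0;
  lie_jacobi : forall x y z : L,
    lie x (lie y z) + lie y (lie z x) + lie z (lie x y) = 0
}.

#[short(type="lieAlgType")]
HB.structure Definition LieAlgebra (K : fieldType) :=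
  { L of isLie K L & Vector K L }.

Section LieTheory.
Variables (K : fieldType) (L : lieAlgType K).
Implicit Types (U V I : {vspace L}).

Definition lie_span U V : {vspace L} :=
  <<[seq lie u v | u <- vbasis U, v <- vbasis V]>>%VS.

Definition lower_central U n := iter n (lie_span U) U.

Definition derived_series U n := iter n (fun V => lie_span V V) U.

Definition nilpotent_lie U := exists n, lower_central U n = 0%VS.

Definition solvable_lie U := exists n, derived_series U n = 0%VS.

Definition is_subalgebra U :=
  forall x y, x \in U -> y \in U -> lie x y \in U.

Definition is_ideal I := forall x y, y \in I -> lie x y \in I.

Definition semisimple_lie :=
  forall I, is_ideal I -> solvable_lie I -> I = 0%VS.

Definition is_cartan U :=
  [/\ is_subalgebra U, nilpotent_lie U
    & forall x, (forall y, y \in U -> lie x y \in U) -> x \in U].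

Definition trace (f : L -> L) : K :=
  \sum_i coord (vbasis {:L}) i (f (vbasis {:L})`_i).

Definition killing (x y : L) : K := trace (fun z => lie x (lie y z)).

Definition dual U := 'Hom(subvs_of U, K^o).

Definition weight_vector U (a : dual U) (x : L) :=
  forall t : subvs_of U, lie (vsval t) x = (a t : K) *: x.

End LieTheory.

(* A complex vector space regarded as a real one. *)
Definition realif (R : rcfType) (V : vectType R[i]) : Type := V.

Section Realification.
Variables (R : rcfType) (V : vectType R[i]).
Local Notation VR := (realif V).

HB.instance Definition _ := GRing.Zmodule.on VR.

Definition realif_scale (a : R) (v : VR) : VR := a%:C%C *: (v : V).

Fact realif_scaleA a b v :
  realif_scale a (realif_scale b v) = realif_scale (a * b) v.
Proof. by rewrite /realif_scale scalerA rmorphM. Qed.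
Fact realif_scale1 : left_id 1 realif_scale.
Proof. by move=> v; rewrite /realif_scale rmorph1 scale1r. Qed.
Fact realif_scaleDr : right_distributive realif_scale +%R.
Proof. by move=> a u v; rewrite /realif_scale; exact: scalerDr. Qed.
Fact realif_scaleDl v : {morph realif_scale^~ v : a b / a + b}.
Proof. by move=> a b; rewrite /realif_scale rmorphD; exact: scalerDl. Qed.

HB.instance Definition _ := GRing.Zmodule_isLmodule.Build R VR
  realif_scaleA realif_scale1 realif_scaleDr realif_scaleDl.

Lemma realif_scaleE (a : R) (v : VR) : a *: v = a%:C%C *: (v : V).
Proof. by []. Qed.

Local Notation dV := (\dim {:V}).

Definition realif_coord (v : VR) (j : 'I_dV) : R[i] :=
  coord (vbasis {:V}) j (v : V).

Definition realif_row (v : VR) : 'rV[R]_(dV + dV) :=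
  row_mx (\row_j complex.Re (realif_coord v j))
         (\row_j complex.Im (realif_coord v j)).

Definition realif_vec (r : 'rV[R]_(dV + dV)) : VR :=
  (\sum_j Complex (lsubmx r 0 j) (rsubmx r 0 j) *: (vbasis {:V})`_j : V).

Fact realif_coordP a u v j :
  realif_coord (a *: u + v) j = a%:C%C * realif_coord u j + realif_coord v j.
Proof. by rewrite /realif_coord -linearP. Qed.

Fact realif_vect_iso : vector_axiom_def (dV + dV) VR.
Proof.
exists realif_row.
  move=> a u v; rewrite /realif_row scale_row_mx add_row_mx.
  congr row_mx; apply/rowP=> j; rewrite !mxE realif_coordP;
    case: (realif_coord u j) (realif_coord v j) => [x y] [z t] /=.
    by rewrite mul0r subr0.
  by rewrite mul0r addr0.
exists realif_vec.
  move=> v; rewrite /realif_vec /realif_row row_mxKl row_mxKr.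
  rewrite [RHS](coord_vbasis (memvf (v : V))).
  apply: eq_bigr => j _; rewrite !mxE /realif_coord.
  by case: (coord _ _ _).
move=> r; rewrite /realif_row -[RHS]hsubmxK.
congr row_mx; apply/rowP=> j; rewrite !mxE /realif_coord /realif_vec;
  by rewrite coord_sum_free ?(basis_free (vbasisP _)) //= !mxE.
Qed.

HB.instance Definition _ := Lmodule_hasFinDim.Build R VR realif_vect_iso.

End Realification.

Section RootData.
Variables (R : rcfType) (L : lieAlgType R[i]) (h : {vspace L}).
Implicit Types (Phi Sigma : seq (dual h)) (X : dual h -> L).

Definition is_root_set Phi := uniq Phi /\
  forall a : dual h,
    a \in Phi <-> a != 0 /\ (exists2 x : L, x != 0 & weight_vector a x).

Definition is_coroot_family Phi (H : dual h -> L) :=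
  forall a, a \in Phi -> H a \in h /\
    forall t : subvs_of h, a t = killing (vsval t) (H a).

Definition simple_system Phi Sigma :=
  [/\ free Sigma, {subset Sigma <= Phi}
    & forall a, a \in Phi -> exists c : 'I_(size Sigma) -> nat,
        let b := \sum_(i < size Sigma) Sigma`_i *+ c i in a = b \/ a = - b].

(* 0 <= z in R[i] means that z is real and nonnegative *)
Definition pos_root Sigma (a : dual h) : bool :=
  [forall i, 0 <= coord (in_tuple Sigma) i a].

(* The vectors X a together with the Cartan subalgebra h span L.  The relation
   with n is not required for b = - a, where [X a, X (- a)] lies in h.  Only
   the values of X and n at elements of Phi are relevant. *)
Definition weyl_basis Phi X (n : dual h -> dual h -> R) :=
  [/\ forall a, a \in Phi -> weight_vector a (X a),
      (h + \sum_(a <- Phi) <[X a]> = fullv)%VS,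
      forall a, a \in Phi -> killing (X a) (X (- a)) = 1,
      forall a b, a \in Phi -> b \in Phi -> a + b != 0 ->
        lie (X a) (X b) = (n a b)%:C%C *: X (a + b)
    & forall a b, a \in Phi -> b \in Phi ->
        (n a b != 0 <-> a + b \in Phi) /\ n a b = - n (- a) (- b)].

End RootData.

Record flag_data (R : rcfType) (L : lieAlgType R[i]) := FlagData {
  cartan : {vspace L};
  cartanP : is_cartan cartan;
  roots : seq (dual cartan);
  rootsP : is_root_set roots;
  Hroot : dual cartan -> L;
  HrootP : is_coroot_family roots Hroot;
  simples : seq (dual cartan);
  simplesP : simple_system roots simples;
  Theta : seq (dual cartan);
  ThetaP : {subset Theta <= simples};
  weylX : dual cartan -> L;
  weyln : dual cartan -> dual cartan -> R;
  weylP : weyl_basis roots weylX weyln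
}.

Arguments Hroot {R L} f _.
Arguments weylX {R L} f _.
Arguments weyln {R L} f _ _.

Section Flag.
Variables (R : rcfType) (L : lieAlgType R[i]) (F : flag_data L).
Local Notation LR := (realif L).
Local Notation CR := (realif R[i]^o).
Local Notation h := (cartan F).
Local Notation X := (weylX F).

Definition roots_Theta : seq (dual h) :=
  [seq a <- roots F | a \in <<Theta F>>%VS].

Definition roots_Theta_pos : seq (dual h) :=
  [seq a <- roots_Theta | pos_root (simples F) a].

Definition roots_M : seq (dual h) :=
  [seq a <- roots F | a \notin <<Theta F>>%VS].

Definition roots_M_pos : seq (dual h) :=
  [seq a <- roots_M | pos_root (simples F) a].

Definition u_ (a : dual h) : {vspace LR} :=
  <<[:: (X a - X (- a) : LR); ('i%C *: (X a + X (- a)) : LR)]>>%VS.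

Definition ihR : {vspace LR} :=
  <<[seq ('i%C *: Hroot F a : LR) | a <- roots F]>>%VS.

Definition kTheta : {vspace LR} :=
  (ihR + \sum_(a <- roots_Theta_pos) u_ a)%VS.

Definition tangent : {vspace LR} := (\sum_(a <- roots_M_pos) u_ a)%VS.

(* The root a as a real-linear function; meaningful on vectors of h only. *)
Definition root_fun (a : dual h) (H : LR) : CR := a (vsproj h (H : L)).

Definition rootR (a : dual h) : 'Hom(LR, CR) := linfun (root_fun a).

Fact root_fun_linear a : linear (root_fun a).
Proof.
move=> c x y; rewrite /root_fun realif_scaleE.
have -> : vsproj h (c%:C%C *: (x : L) + (y : L))
  = c%:C%C *: vsproj h (x : L) + vsproj h (y : L) by rewrite linearP.
by rewrite linearP.
Qed.

HB.instance Definition _ a :=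
  GRing.isLinear.Build R LR CR *:%R (root_fun a) (root_fun_linear a).

Lemma rootRE a (H : LR) : rootR a H = a (vsproj h (H : L)).
Proof. by rewrite lfunE. Qed.

Definition tcenter : {vspace LR} :=
  (ihR :&: \bigcap_(a <- roots_Theta) lker (rootR a))%VS.

Definition troot := 'Hom(subvs_of tcenter, CR).

Definition kappa (a : dual h) : troot := (rootR a \o linfun vsval)%VF.

Lemma kappaE a (H : subvs_of tcenter) :
  kappa a H = a (vsproj h (vsval H : L)).
Proof. by rewrite comp_lfunE rootRE lfunE. Qed.

Definition troots : seq troot := undup [seq kappa a | a <- roots_M].

Definition troots_pos : seq troot := undup [seq kappa a | a <- roots_M_pos].

Definition tangent_ (xi : troot) : {vspace LR} :=
  (\sum_(a <- roots_M_pos | kappa a == xi) u_ a)%VS.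

Local Notation m := (subvs_of tangent).

(* The projection onto the tangent space along kTheta. *)
Definition mproj (v : L) : m := vsproj tangent (daddv_pi tangent kTheta (v : LR)).

Definition mbracket (x y : m) : m := mproj (lie (vsval x : L) (vsval y : L)).

(* ad z preserves the tangent space when z lies in kTheta, so that the
   projection does not change [z, x]. *)
Definition isotropy (z : LR) (x : m) : m := mproj (lie (z : L) (vsval x : L)).

Definition invariant_acs (J : 'End(m)) :=
  (forall x, J (J x) = - x) /\
  (forall z x, z \in kTheta -> J (isotropy z x) = isotropy z (J x)).

(* J^C is a complex-linear map extending J; it is determined by J on the
   complexification of the tangent space, spanned by the X_a with a in R_M. *)
Definition acs_signs (J : 'End(m)) (eps : troot -> R) :=
  [/\ forall d, d \in troots -> eps d = 1 \/ eps d = -1,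
      forall d, d \in troots -> eps (- d) = - eps d
    & exists JC : 'End(L),
        (forall x : m, JC (vsval x : L) = vsval (J x)) /\
        (forall a, a \in roots_M ->
           JC (X a) = ('i%C * (eps (kappa a))%:C%C) *: X a)].

Definition invariant_metric (g : m -> m -> R) :=
  [/\ forall x y, g x y = g y x,
      forall c x y z, g (c *: x + y) z = c * g x z + g y z,
      forall x, x != 0 -> 0 < g x x
    & forall z x y, z \in kTheta ->
        g (isotropy z x) y + g x (isotropy z y) = 0].

Definition metric_coeffs (g : m -> m -> R) (lam : troot -> R) :=
  [/\ forall d, d \in troots -> 0 < lam d,
      forall d, d \in troots -> lam (- d) = lam d
    & forall x y : troot -> m,
        (forall xi, xi \in troots_pos ->
           vsval (x xi) \in tangent_ xi /\ vsval (y xi) \in tangent_ xi) ->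
        (g (\sum_(xi <- troots_pos) x xi) (\sum_(xi <- troots_pos) y xi))%:C%C
        = - \sum_(xi <- troots_pos)
              (lam xi)%:C%C * killing (vsval (x xi) : L) (vsval (y xi) : L)].

(* The normalization is -N(x, y)/2 = - [Jx, Jy] + [x, y] + J[x, Jy] + J[Jx, y]. *)
Definition nijenhuis (J : 'End(m)) (x y : m) : m :=
  (-2) *: (- mbracket (J x) (J y) + mbracket x y
           + J (mbracket x (J y)) + J (mbracket (J x) y)).

Definition G1_structure (g : m -> m -> R) (J : 'End(m)) :=
  forall x y : m, g (nijenhuis J x y) x = 0.

Definition zero_sum_triple (d z e : troot) :=
  [/\ d \in troots, z \in troots, e \in troots & d + z + e = 0].

Definition triple03 (eps : troot -> R) (d z e : troot) :=
  zero_sum_triple d z e /\ (eps d = eps z /\ eps z = eps e).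

End Flag.

(* Main.v *)
(* Extend B, J, the projection to m and the metric C-linearly, so that G1 becomes
   the vanishing of Q(u,v,w) = g(N(u,v),w) + g(N(w,v),u) on root vectors.  It
   vanishes at (X_a,X_b,X_c) unless a+b+c = 0, in which case, n being cyclic on
   such triples,
     Q = 2 (1 + e_a e_b + e_b e_c + e_c e_a) n_(a,b) (lambda_c - lambda_a),
   and the factor in e is 4 when the three signs agree and 0 otherwise.
   Moreover a zero-sum triple of nonzero t-roots lifts to a zero-sum triple of
   roots: the barycenters of the coroots over the three t-roots add up to 0, so
   two of them have negative product, hence so do some roots a, b above them, and
   then a+b is a root.  Root strings are replaced throughout by the identity
   b(H_a) = n_(-a,b)^2 - n_(a,b)^2 for b <> a, -a. *)
Require Import Defs.
From HB Require Import structures.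
From mathcomp Require Import all_boot all_order all_algebra.
From mathcomp Require Import complex.
From mathcomp Require Import reals.
From mathcomp Require Import ring lra.

Set Implicit Arguments.
Unset Strict Implicit.
Unset Printing Implicit Defensive.

Import Order.TTheory GRing.Theory Num.Theory.
Local Open Scope ring_scope.

(** The order on R[i] is partial, so the dichotomy needs y and z to be real. It will pick a negative
    product among those of one barycenter with the other two. *)
Lemma addr3_eq0_lt0 (K : numDomainType) (x y z : K) : 0 < x ->
  y \is Num.real -> z \is Num.real -> x + y + z = 0 -> y < 0 \/ z < 0.
Proof.
move=> x0 yR zR xyz; case: (real_ltP yR (rpred0 _)) => [|y0]; first by left.
case: (real_ltP zR (rpred0 _)) => [|z0]; first by right.
by have := ltr_wpDr z0 (ltr_wpDr y0 x0); rewrite xyz ltxx.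
Qed.

(** * Membership and induction in sums of subspaces *)

Section VspaceInd.
Variables (K : fieldType) (V : vectType K) (P : V -> Prop).
Hypotheses (P0 : P 0) (PD : forall u v, P u -> P v -> P (u + v)).

Lemma memv_bigsum_ind (I : eqType) (s : seq I) (U : I -> {vspace V}) :
  (forall i u, i \in s -> u \in U i -> P u) ->
  forall v, v \in (\sum_(i <- s) U i)%VS -> P v.
Proof.
elim: s => [|i s IHs] PU v; first by rewrite big_nil memv0 => /eqP->.
rewrite big_cons => /memv_addP[u Uu [w sw ->]]; apply: PD.
  by apply: PU Uu; rewrite mem_head.
by apply: IHs sw => j w' js; apply: PU; rewrite inE js orbT.
Qed.

Lemma memv_span_ind (s : seq V) :
  (forall a u, u \in s -> P (a *: u)) -> forall v, v \in <<s>>%VS -> P v.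
Proof.
move=> Ps; elim: s Ps => [|u s IHs] Ps v.
  by rewrite span_nil memv0 => /eqP->.
rewrite span_cons => /memv_addP[_ /vlineP[a ->] [w sw ->]]; apply: PD.
  by apply: Ps; rewrite mem_head.
by apply: IHs sw => b x xs; apply: Ps; rewrite inE xs orbT.
Qed.

End VspaceInd.

Lemma memv_bigsum (K : fieldType) (V : vectType K) (I : eqType) (s : seq I)
    (P : pred I) (U : I -> {vspace V}) i v :
  i \in s -> P i -> v \in U i -> v \in (\sum_(j <- s | P j) U j)%VS.
Proof.
move=> si Pi; apply/subvP; elim: s si => // j s IHs.
rewrite inE big_cons => /predU1P[<-|/IHs Us]; first by rewrite Pi addvSl.
by case: ifP => // _; apply: subv_trans Us _; exact: addvSr.
Qed.

Lemma memv_bigcap_seq (K : fieldType) (V : vectType K) (I : eqType) (s : seq I)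
    (U : I -> {vspace V}) v :
  (v \in (\bigcap_(i <- s) U i)%VS) = all (fun i => v \in U i) s.
Proof.
elim: s => [|i s IHs]; first by rewrite big_nil memvf.
by rewrite big_cons memv_cap IHs.
Qed.

(** * Bracket, trace and Killing form B in an arbitrary Lie algebra *)

Section LieLemmas.
Variables (K : fieldType) (L : lieAlgType K).
Implicit Types (x y z : L).

Fact lie_linear x : linear (lie x).
Proof. by move=> a y z; rewrite lie_linearr. Qed.
HB.instance Definition _ x := GRing.isLinear.Build K L L *:%R (lie x) (lie_linear x).

Lemma lieDl x y z : lie (x + y) z = lie x z + lie y z.
Proof. by rewrite -[x]scale1r lie_linearl !scale1r. Qed.

Lemma lieDr x y z : lie z (x + y) = lie z x + lie z y.
Proof. exact: linearD. Qed.

Lemma lieZr a x y : lie x (a *: y) = a *: lie x y.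
Proof. exact: linearZ. Qed.

Lemma lieBr x y z : lie z (x - y) = lie z x - lie z y.
Proof. exact: linearB. Qed.

Lemma lie0l x : lie 0 x = 0.
Proof. by apply: (addrI (lie 0 x)); rewrite -lieDl !addr0. Qed.

Lemma lieZl a x y : lie (a *: x) y = a *: lie x y.
Proof. by rewrite -[a *: x]addr0 lie_linearl lie0l addr0. Qed.

Lemma lieNl x y : lie (- x) y = - lie x y.
Proof. by rewrite -scaleN1r lieZl scaleN1r. Qed.

Lemma lieBl x y z : lie (x - y) z = lie x z - lie y z.
Proof. by rewrite lieDl lieNl. Qed.

Lemma lieC x y : lie x y = - lie y x.
Proof.
apply/eqP; rewrite -addr_eq0; apply/eqP.
by rewrite -[RHS](liexx (x + y)) linearD /= !lieDl !liexx addr0 add0r addrC.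
Qed.

Lemma lie_lie x y z : lie (lie x y) z = lie x (lie y z) - lie y (lie x z).
Proof.
apply/eqP; rewrite -subr_eq0; apply/eqP; rewrite -[RHS]oppr0.
rewrite -(lie_jacobi x y z) (lieC (lie x y)) (lieC z x) raddfN /=.
by rewrite !opprD !opprK addrC -addrA addrC; do 2 congr (_ + _); rewrite addrC.
Qed.

Lemma lie_suml I (r : seq I) (P : pred I) (E : I -> L) y :
  lie (\sum_(i <- r | P i) E i) y = \sum_(i <- r | P i) lie (E i) y.
Proof.
by apply: (big_morph (lie^~ y)) => [u v|]; [exact: lieDl | exact: lie0l].
Qed.

Lemma eq_trace (f g : L -> L) : f =1 g -> trace f = trace g.
Proof. by move=> fg; apply: eq_bigr => i _; rewrite fg. Qed.

Lemma traceD (f g : L -> L) : trace (fun x => f x + g x) = trace f + trace g.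
Proof. by rewrite -big_split; apply: eq_bigr => i _; rewrite linearD. Qed.

Lemma traceZ a (f : L -> L) : trace (fun x => a *: f x) = a * trace f.
Proof. by rewrite mulr_sumr; apply: eq_bigr => i _; rewrite linearZ. Qed.

Lemma traceB (f g : L -> L) : trace (fun x => f x - g x) = trace f - trace g.
Proof. by rewrite -sumrB; apply: eq_bigr => i _; rewrite linearB. Qed.

Lemma trace_sum I (r : seq I) (f : I -> L -> L) :
  trace (fun x => \sum_(i <- r) f i x) = \sum_(i <- r) trace (f i).
Proof. by rewrite exchange_big; apply: eq_bigr => i _; rewrite linear_sum. Qed.

(** The operator has its image in the line of w; [killing_cartan] sums such traces over the root
    vectors. *)
Lemma trace_rank1 (phi : {linear L -> K^o}) (w : L) :
  trace (fun x => (phi x : K) *: w) = phi w.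
Proof.
rewrite [in RHS](coord_vbasis (memvf w)) linear_sum.
by apply: eq_bigr => i _; rewrite !linearZ /= mulrC.
Qed.

Lemma trace_comm (f g : {linear L -> L}) :
  trace (fun x => f (g x)) = trace (fun x => g (f x)).
Proof.
(* The trace as a double sum over matrix entries; exchanging the summations gives that of the
   product in the other order. *)
have E (f' g' : {linear L -> L}) : trace (fun x => f' (g' x)) =
   \sum_(i < \dim {:L}) \sum_j coord (vbasis {:L}) j (g' (vbasis {:L})`_i)
              * coord (vbasis {:L}) i (f' (vbasis {:L})`_j).
  apply: eq_bigr => i _.
  rewrite [in LHS](coord_vbasis (memvf (g' _))) !linear_sum.
  by apply: eq_bigr => j _; rewrite !linearZ.
rewrite !E exchange_big; apply: eq_bigr => i _; apply: eq_bigr => j _.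
by rewrite mulrC.
Qed.

Lemma killingC x y : killing x y = killing y x.
Proof. exact: (trace_comm (lie x) (lie y)). Qed.

Lemma killing_linear x : linear (killing x : L -> K^o).
Proof.
move=> a y z; rewrite /killing -[RHS]/(a * _ + _) -traceZ -traceD; apply: eq_trace => v.
by rewrite lie_linearl linearP.
Qed.
HB.instance Definition _ x :=
  GRing.isLinear.Build K L K^o *:%R (killing x) (killing_linear x).

(** With brackets expanded as commutators, both sides contain tr(ad x ad y ad z), and the remaining
    terms tr(ad y ad x ad z) and tr(ad x ad z ad y) agree by cyclicity. *)
Lemma killing_invariant x y z : killing (lie x y) z = killing x (lie y z).
Proof.
rewrite /killing.
under eq_trace do rewrite lie_lie.
under [RHS]eq_trace do rewrite lie_lie raddfB /=.
rewrite !traceB; congr (_ - _).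
by rewrite (trace_comm (lie y) (lie x \o lie z)).
Qed.

Lemma killingZl a x y : killing (a *: x) y = a * killing x y.
Proof. by rewrite killingC linearZ /= killingC. Qed.

Lemma killingDl x y z : killing (x + y) z = killing x z + killing y z.
Proof. by rewrite killingC linearD /= !(killingC z). Qed.

Lemma killing0l x : killing 0 x = 0.
Proof. by rewrite killingC linear0. Qed.

Lemma killing_suml I (r : seq I) (P : pred I) (E : I -> L) y :
  killing (\sum_(i <- r | P i) E i) y = \sum_(i <- r | P i) killing (E i) y.
Proof. by rewrite killingC linear_sum; apply: eq_bigr => i _; rewrite killingC. Qed.

Lemma killingDr x y z : killing z (x + y) = killing z x + killing z y.
Proof. exact: linearD. Qed.

Lemma killingZr a x y : killing y (a *: x) = a * killing y x.
Proof. exact: linearZ. Qed.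

Lemma killing_sumr I (r : seq I) (P : pred I) (E : I -> L) y :
  killing y (\sum_(i <- r | P i) E i) = \sum_(i <- r | P i) killing y (E i).
Proof. exact: linear_sum. Qed.

Lemma mem_lie_span (U V : {vspace L}) x y :
  x \in U -> y \in V -> lie x y \in lie_span U V.
Proof.
move=> Ux Vy; rewrite (coord_vbasis Ux) lie_suml rpred_sum // => i _.
rewrite lieZl rpredZ // (coord_vbasis Vy) linear_sum rpred_sum // => j _.
rewrite linearZ rpredZ //= memv_span //; apply/allpairsP.
by exists ((vbasis U)`_i, (vbasis V)`_j); split; rewrite // mem_nth ?size_tuple.
Qed.

Lemma lie_span_sub (U V W : {vspace L}) :
  (forall x y, x \in U -> y \in V -> lie x y \in W) -> (lie_span U V <= W)%VS.
Proof.
move=> UVW; apply/span_subvP => _ /allpairsP[[x y] [xU yV ->]] /=.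
by apply: UVW; exact: vbasis_mem.
Qed.

(** A subalgebra of a nilpotent V is thereby solvable. The inclusion in U is carried along because
    the inductive step needs one factor in V. *)
Lemma derived_sub_lower_central (U V : {vspace L}) n :
  (U <= V)%VS -> is_subalgebra U ->
  (derived_series U n <= U)%VS /\ (derived_series U n <= lower_central V n)%VS.
Proof.
move=> UV subU; elim: n => [|n [IHU IHV]] //=.
split; apply: lie_span_sub => x y xD yD.
  by apply: subU; exact: (subvP IHU).
by apply: mem_lie_span; [apply: (subvP UV); exact: (subvP IHU)|exact: (subvP IHV)].
Qed.

End LieLemmas.

(** * Root vectors, coroots and the Cartan subalgebra *)

Section Roots.
Variables (R : rcfType) (L : lieAlgType R[i]).
Hypothesis (hL : semisimple_lie L).
Variable (F : flag_data L).
Local Notation h := (cartan F).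
Local Notation X := (weylX F).
Local Notation H := (Hroot F).
Local Notation Phi := (Defs.roots F).
Local Notation n := (weyln F).
Implicit Types (a b c : dual h) (s t : L).

(* The value of a linear form on h at a vector of L; meaningful on h only. *)
Definition ev a t : R[i] := a (vsproj h t).

Fact ev_linear a : linear (ev a : L -> R[i]^o).
Proof. by move=> k x y; rewrite /ev !linearP. Qed.
HB.instance Definition _ a :=
  GRing.isLinear.Build R[i] L R[i]^o *:%R (ev a) (ev_linear a).

Lemma evD a b t : ev (a + b) t = ev a t + ev b t.
Proof. by rewrite /ev add_lfunE. Qed.

Lemma evN a t : ev (- a) t = - ev a t.
Proof. by rewrite /ev opp_lfunE. Qed.

Lemma ev_inj a b : {in h, ev a =1 ev b} -> a = b.
Proof.
move=> ab; apply/lfunP => u; have := ab _ (subvsP u).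
by rewrite /ev vsvalK.
Qed.

Lemma root_neq0 a : a \in Phi -> a != 0.
Proof. by case: (Defs.rootsP F) => _ /(_ a) -[+ _] => /[apply] -[]. Qed.

Lemma lie_weyl t a : t \in h -> a \in Phi -> lie t (X a) = ev a t *: X a.
Proof.
move=> ht aP; have [+ _ _ _ _] := weylP F => /(_ a aP (vsproj h t)).
by rewrite vsprojK.
Qed.

Lemma killing_weyl_opp a : a \in Phi -> killing (X a) (X (- a)) = 1.
Proof. by move=> aP; have [_ _ /(_ a aP)] := weylP F. Qed.

Lemma lie_weyl2 a b : a \in Phi -> b \in Phi -> a + b != 0 ->
  lie (X a) (X b) = (n a b)%:C%C *: X (a + b).
Proof. by move=> aP bP ab; have [_ _ _ + _] := weylP F; apply. Qed.

Lemma weyl_neq0 a : a \in Phi -> X a != 0.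
Proof.
move=> /killing_weyl_opp; apply: contra_eq_neq => ->.
by rewrite killing0l eq_sym oner_eq0.
Qed.

Lemma weyl_ind (P : L -> Prop) : P 0 -> (forall u v, P u -> P v -> P (u + v)) ->
  {in h, forall t, P t} -> (forall a k, a \in Phi -> P (k *: X a)) ->
  forall v, P v.
Proof.
move=> P0 PD Ph PX v; have [_ + _ _ _] := weylP F => fullE.
have: v \in fullv by rewrite memvf.
rewrite -fullE => /memv_addP[t ht [w Xw ->]].
apply: (PD t w); first exact: Ph.
apply: (memv_bigsum_ind P0 PD _ Xw) => a _ aP /vlineP[k ->].
exact: PX.
Qed.

Lemma cartan_lie s t : s \in h -> t \in h -> lie s t \in h.
Proof. by have [sub _ _] := cartanP F; exact: sub. Qed.

(** [s, t] acts on X_a by the commutator of two scalars. At this point h is not yet known to be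
    abelian. *)
Lemma ev_lie s t a : s \in h -> t \in h -> a \in Phi -> ev a (lie s t) = 0.
Proof.
move=> hs ht aP; apply/eqP; rewrite -[_ == 0]orbF -(negPf (weyl_neq0 aP)).
rewrite -scaler_eq0 -lie_weyl ?cartan_lie // lie_lie !lie_weyl //.
rewrite !linearZ /= !lie_weyl // !scalerA.
by rewrite scalerN scalerA mulrC subrr.
Qed.

(* The common kernel of the roots is a solvable ideal. *)
Lemma cartan_eq0 t : t \in h -> {in Phi, forall a, ev a t = 0} -> t = 0.
Proof.
move=> ht at0.
pose Z := (h :&: \bigcap_(a <- Phi) lker (linfun (ev a : L -> R[i]^o)))%VS.
have memZ u : (u \in Z) = (u \in h) && all (fun a => ev a u == 0) Phi.
  rewrite memv_cap memv_bigcap_seq; congr (_ && _).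
  by apply: eq_all => a; rewrite memv_ker lfunE.
have Zideal : is_ideal Z.
  move=> x y; rewrite memZ => /andP[hy /allP y0]; elim/weyl_ind: x.
  - by rewrite lie0l mem0v.
  - by move=> u v Zu Zv; rewrite lieDl memvD.
  - move=> s hs; rewrite memZ cartan_lie //=.
    by apply/allP => a aP; rewrite ev_lie.
  - move=> a k aP; rewrite lieZl lieC lie_weyl // (eqP (y0 a aP)).
    by rewrite scale0r oppr0 scaler0 mem0v.
(* Z is solvable, being a subalgebra of the nilpotent h. *)
have /eqP Z0 : Z == 0%VS.
  apply/eqP/hL => //; have [_ [N lcN] _] := cartanP F; exists N.
  apply/eqP; rewrite -subv0 -lcN.
  apply: (proj2 (derived_sub_lower_central _ _ _)); first exact: capvSl.
  by move=> x y _; exact: Zideal.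
have: t \in Z by rewrite memZ ht; apply/allP => a aP; rewrite at0.
by rewrite Z0 memv0 => /eqP.
Qed.

Lemma cartan_abelian s t : s \in h -> t \in h -> lie s t = 0.
Proof.
by move=> hs ht; apply: cartan_eq0; [exact: cartan_lie|move=> a; exact: ev_lie].
Qed.

Lemma ev_neq0 a : a != 0 -> exists2 t, t \in h & ev a t != 0.
Proof.
case: (boolP (has (fun t => ev a t != 0) (vbasis h))) => [/hasP[t ht] ? _|].
  by exists t => //; exact: vbasis_mem.
move=> /hasPn a0 /eqP[]; apply: ev_inj => t ht.
rewrite (coord_vbasis ht) !linear_sum; apply: eq_bigr => i _.
rewrite !linearZ /= {2}/ev zero_lfunE; congr (_ *: _).
by apply/eqP/negPn/a0; rewrite mem_nth ?size_tuple.
Qed.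

(** a(s) B(t, X_a) = B(t, [s, X_a]) = B([t, s], X_a) = 0, with s chosen so that a(s) is not 0. *)
Lemma killing_cartan_weyl t a : t \in h -> a \in Phi -> killing t (X a) = 0.
Proof.
move=> ht aP; have [s hs /negPf a0] := ev_neq0 (root_neq0 aP).
apply/eqP; rewrite -[_ == 0]orFb -a0 -mulf_eq0 -[_ * _]/(_ *: (_ : _^o)) -linearZ.
by rewrite -lie_weyl //= -killing_invariant cartan_abelian // killing0l.
Qed.

(** Invariance gives (a + b)(s) B(X_a, X_b) = 0 for all s in h. *)
Lemma killing_weyl_eq0 a b : a \in Phi -> b \in Phi -> a + b != 0 ->
  killing (X a) (X b) = 0.
Proof.
move=> aP bP /ev_neq0[s hs /negPf ab0].
apply/eqP; rewrite -[_ == 0]orFb -ab0 -mulf_eq0 evD mulrDl.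
rewrite -killingZl -lie_weyl // -[ev b s * _]/(_ *: (_ : _^o)) -linearZ /=.
by rewrite -lie_weyl // -killing_invariant lieC -killingDl addNr killing0l.
Qed.

(** Otherwise X_a would be orthogonal to h and to every root vector, hence to all of L, although
    B(X_a, [X (- a)]) = 1. *)
Lemma oppr_root a : a \in Phi -> - a \in Phi.
Proof.
move=> aP; apply/negPn/negP => NaP.
have /eqP : killing (X a) (X (- a)) = 0.
  elim/weyl_ind: (X (- a)) => [|u v u0 v0|t ht|b k bP].
  - by rewrite linear0.
  - by rewrite linearD /= u0 v0 addr0.
  - by rewrite killingC killing_cartan_weyl.
  rewrite linearZ /= killing_weyl_eq0 ?scaler0 // addr_eq0.
  by apply: contraNneq NaP => ->; rewrite opprK.
by rewrite killing_weyl_opp // oner_eq0.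
Qed.

Lemma killing_weyl a b : a \in Phi -> b \in Phi ->
  killing (X a) (X b) = (a + b == 0)%:R.
Proof.
move=> aP bP; case: eqP => [|/eqP ab]; last exact: killing_weyl_eq0.
by rewrite addrC => /eqP; rewrite addr_eq0 => /eqP ->; exact: killing_weyl_opp.
Qed.

Lemma coroot_cartan a : a \in Phi -> H a \in h.
Proof. by move=> /HrootP[]. Qed.

Lemma ev_coroot a t : a \in Phi -> t \in h -> ev a t = killing t (H a).
Proof. by move=> /HrootP[_ aH] ht; rewrite /ev aH vsprojK. Qed.

Lemma ev_corootC a b : a \in Phi -> b \in Phi -> ev a (H b) = ev b (H a).
Proof.
by move=> aP bP; rewrite !ev_coroot ?coroot_cartan // killingC.
Qed.

(** The bracket commutes with h, hence lies in the self-normalizing h. Pairing with H_b shows that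
    every root b vanishes on its difference with H_a. *)
Lemma lie_weyl_opp a : a \in Phi -> lie (X a) (X (- a)) = H a.
Proof.
move=> aP; have NaP := oppr_root aP.
have hz : lie (X a) (X (- a)) \in h.
  have [_ _ selfnorm] := cartanP F; apply: selfnorm => t ht.
  rewrite lie_lie (lieC (X (- a)) t) (lieC (X a) t) !lie_weyl // evN.
  rewrite !linearN !linearZ /= (lieC (X (- a))) scaleNr.
  by rewrite opprK scalerN opprK subrr mem0v.
apply/eqP; rewrite -subr_eq0; apply/eqP/cartan_eq0.
  by rewrite memvB ?coroot_cartan.
move=> b bP; rewrite ev_coroot ?memvB ?coroot_cartan // killingC linearB /=.
rewrite -killing_invariant lie_weyl ?coroot_cartan // killingZl killing_weyl_opp //.
by rewrite mulr1 ev_coroot ?coroot_cartan // subrr.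
Qed.

(** * Symmetries of the structure constants *)

Lemma weyln_neq0 a b : a \in Phi -> b \in Phi -> (n a b != 0) = (a + b \in Phi).
Proof.
move=> aP bP; have [_ _ _ _ /(_ a b aP bP)[nP _]] := weylP F.
by apply/idP/idP => /nP.
Qed.

Lemma weyln_opp a b : a \in Phi -> b \in Phi -> n (- a) (- b) = - n a b.
Proof.
by move=> aP bP; have [_ _ _ _ /(_ a b aP bP)[_ ->]] := weylP F; rewrite opprK.
Qed.

Lemma weylnC a b : a \in Phi -> b \in Phi -> n b a = - n a b.
Proof.
move=> aP bP; case: (boolP (a + b \in Phi)) => [abP | abNP].
  have /eqP := lieC (X b) (X a).
  rewrite !lie_weyl2 ?root_neq0 // 1?addrC // -subr_eq0 opprK.
  rewrite -scalerDl scaler_eq0 (negPf (weyl_neq0 abP)) orbF -rmorphD /=.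
  by rewrite fmorph_eq0 addr_eq0 => /eqP.
have /eqP-> : n a b == 0 by apply: contraNT abNP; rewrite weyln_neq0.
by apply/eqP; rewrite oppr0; apply: contraNT abNP; rewrite weyln_neq0 // addrC.
Qed.

(** Both sides are read off B([X_a, X_b], X_c) = B(X_a, [X_b, X_c]), since a + b = -c and b + c =
    -a. *)
Lemma weyln_cycle a b c : a \in Phi -> b \in Phi -> c \in Phi ->
  a + b + c = 0 -> n a b = n b c.
Proof.
move=> aP bP cP abc0.
have abE : a + b = - c by apply/eqP; rewrite -addr_eq0 abc0.
have bcE : b + c = - a by apply/eqP; rewrite -addr_eq0 addrC addrA abc0.
have := killing_invariant (X a) (X b) (X c).
rewrite !lie_weyl2 ?abE ?bcE ?oppr_eq0 ?root_neq0 // killingZl linearZ /=.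
rewrite killing_weyl_opp // killingC killing_weyl_opp // mulr1 [_ *: _]mulr1.
by move/(congr1 (@complex.Re _)).
Qed.

(** Two rotations of the triple (-a, a + b, -b) lead to n(-b, -a), hence to n(a, b). This is why
    squares of n appear in double brackets. *)
Lemma weyln_shift a b : a \in Phi -> b \in Phi -> a + b \in Phi ->
  n (- a) (a + b) = n a b.
Proof.
move=> aP bP abP.
have [NaP NbP] := (oppr_root aP, oppr_root bP).
rewrite (weyln_cycle NaP abP NbP) ?addKr ?subrr //.
rewrite (weyln_cycle abP NbP NaP) ?addrK ?subrr //.
by rewrite weyln_opp // weylnC // opprK.
Qed.

Lemma lie_weyl3 a b : a \in Phi -> b \in Phi -> a + b != 0 ->
  lie (X (- a)) (lie (X a) (X b)) = (n a b ^+ 2)%:C%C *: X b.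
Proof.
move=> aP bP ab0; rewrite lie_weyl2 // linearZ /=.
case: (boolP (a + b \in Phi)) => [abP | abNP].
  rewrite lie_weyl2 ?oppr_root // addKr ?root_neq0 // weyln_shift //.
  by rewrite scalerA -rmorphM expr2.
have /eqP-> : n a b == 0 by apply: contraNT abNP; rewrite weyln_neq0.
by rewrite expr0n /= !scale0r.
Qed.

(* The Jacobi identity for X_a, X_(-a), X_b. *)
Lemma ev_coroot_string a b : a \in Phi -> b \in Phi -> b != a -> b != - a ->
  ev b (H a) = (n (- a) b ^+ 2 - n a b ^+ 2)%:C%C.
Proof.
move=> aP bP ba bNa; have NaP := oppr_root aP.
have := lie_weyl3 aP bP; rewrite addrC addr_eq0 => /(_ bNa) E1.
have := lie_weyl3 NaP bP; rewrite opprK addrC subr_eq0 => /(_ ba) E2.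
apply/eqP; rewrite -subr_eq0 -[_ == 0]orbF -(negPf (weyl_neq0 bP)).
rewrite -scaler_eq0 scalerBl -lie_weyl ?coroot_cartan // -lie_weyl_opp //.
by rewrite lie_lie E1 E2 rmorphB scalerBl subrr.
Qed.

(** * The Killing form on h and the reality of the values of roots on coroots *)

Lemma cartan_part v :
  v - \sum_(a <- Phi) killing v (X (- a)) *: X a \in h.
Proof.
elim/weyl_ind: v => [|u v hu hv|t ht|b k bP].
- by rewrite big1 ?subr0 ?mem0v // => a _; rewrite killing0l scale0r.
- under eq_bigr do rewrite killingDl scalerDl.
  by rewrite big_split opprD addrACA memvD.
- rewrite big1_seq ?subr0 // => a /andP[_ aP].
  by rewrite killing_cartan_weyl ?oppr_root // scale0r.
have [uPhi _] := Defs.rootsP F.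
rewrite (bigD1_seq b) //= big1_seq => [|a /andP[ab aP]].
  by rewrite killingZl killing_weyl_opp // mulr1 addr0 subrr mem0v.
rewrite killingZl killing_weyl ?oppr_root // subr_eq0 eq_sym (negPf ab).
by rewrite mulr0 scale0r.
Qed.

(** ad s ad t kills h and multiplies X_a by a(s) a(t); its trace is taken after writing it as a sum
    of rank-one operators. *)
Lemma killing_cartan s t : s \in h -> t \in h ->
  killing s t = \sum_(a <- Phi) ev a s * ev a t.
Proof.
move=> hs ht; transitivity (trace (fun v : L =>
    \sum_(a <- Phi) (ev a s * ev a t) *: (killing (X (- a)) v *: X a))).
  apply: eq_trace => v.
  (* h is abelian, so t annihilates the h-component of v and only the coefficients B(v, X_(-a))
     remain. *)
  have /eqP := cartan_abelian ht (cartan_part v).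
  rewrite linearB subr_eq0 linear_sum => /eqP ->; rewrite linear_sum.
  apply: eq_big_seq => a aP; rewrite !linearZ /= lie_weyl // linearZ /= lie_weyl //.
  by rewrite !scalerA killingC -mulrA [_ * ev a s]mulrC mulrC.
rewrite trace_sum; apply: eq_big_seq => a aP.
by rewrite traceZ trace_rank1 /= killingC killing_weyl_opp // mulr1.
Qed.

Lemma ev_coroot_real_neq a b : a \in Phi -> b \in Phi -> b != a -> b != - a ->
  ev b (H a) \is Num.real.
Proof. by move=> aP bP ba bNa; rewrite ev_coroot_string // complex_real. Qed.

(** a(H_a) = (a + c)(H_a) - c(H_a), where both values are real by the string identity, unless a + c
    = -a; then c = -2a and a(H_a) is half of -c(H_a). *)
Lemma ev_coroot_self_real a c : a \in Phi -> c \in Phi -> a + c \in Phi ->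
  c != a -> c != - a -> ev a (H a) \is Num.real.
Proof.
move=> aP cP acP ca cNa; have cR := ev_coroot_real_neq aP cP ca cNa.
have [acNa | acNa] := eqVneq (a + c) (- a).
  have E : - ev c (H a) = ev a (H a) *+ 2.
    have -> : c = - a *+ 2 by rewrite mulr2n -{1}acNa addrAC subrr add0r.
    by rewrite mulr2n evD evN opprD opprK mulr2n.
  by rewrite -(realrMn _ (n := 2)) // -E rpredN.
have aca : a + c != a by rewrite -subr_eq0 addrC addKr root_neq0.
rewrite -[a in ev a _](addrK c) evD evN rpredB //.
exact: ev_coroot_real_neq.
Qed.

(** The string identity reduces the claim to b = a. A root c other than a and -a with c(H_a) nonzero
    has a + c or a - c a root, and [ev_coroot_self_real] applies. *)
Lemma ev_coroot_real a b : a \in Phi -> b \in Phi -> ev b (H a) \is Num.real.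
Proof.
move=> aP bP; suff aR : ev a (H a) \is Num.real.
  have [->//|ba] := eqVneq b a; have [->|bNa] := eqVneq b (- a).
    by rewrite evN rpredN.
  exact: ev_coroot_real_neq.
case: (boolP (has (fun b => [&& b != a, b != - a & ev b (H a) != 0]) Phi)).
  case/hasP => c cP /and3P[ca cNa].
  have [acP _ | acNP] := boolP (a + c \in Phi).
    exact: ev_coroot_self_real acP ca cNa.
  have [acP _ | acNP'] := boolP (a - c \in Phi).
    apply: (ev_coroot_self_real aP (oppr_root cP) acP).
      by rewrite eqr_oppLR.
    by apply: contra ca => /eqP/oppr_inj->.
  (* Otherwise both structure constants vanish, and with them c(H_a). *)
  have NaP := oppr_root aP.
  have n1 : n a c = 0 by apply/eqP/negPn; rewrite weyln_neq0.
  have n2 : n (- a) c = 0.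
    apply/eqP/negPn; rewrite weyln_neq0 //; apply: contra acNP' => /oppr_root.
    by rewrite opprD opprK.
  by rewrite ev_coroot_string // n1 n2 subrr eqxx.
(* If a is orthogonal to all roots but a and -a, then x = a(H_a) solves
   x = k x^2 for an integer k. *)
move=> /hasPn ortho.
have E : ev a (H a) =
    ev a (H a) ^+ 2 * (\sum_(b <- Phi) ((b == a) || (b == - a))%:R).
  rewrite {1}ev_coroot ?killing_cartan ?coroot_cartan // mulr_sumr.
  apply: eq_big_seq => c /ortho.
  have [->|_] := eqVneq c a; first by rewrite mulr1 expr2.
  have [->|_] := eqVneq c (- a); first by rewrite evN mulrNN orbT mulr1 expr2.
  by rewrite /= negbK => /eqP->; rewrite !mulr0.
set k := \sum_(b <- _) _ in E.
have kR : k \is Num.real by rewrite rpred_sum // => c _; rewrite realn.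
have [->//|a0] := eqVneq (ev a (H a)) 0.
have /divr1_eq <- : k^-1 / ev a (H a) = 1.
  rewrite -invfM; apply/eqP; rewrite invr_eq1 mulrC; apply/eqP.
  by apply: (mulfI a0); rewrite mulrA -expr2 -E mulr1.
by rewrite rpredV.
Qed.

(** * Positive definiteness of B on real combinations of coroots *)

Section RealSpan.
Variable (k : dual h -> R[i]).
Hypothesis (kR : forall a, a \in Phi -> k a \is Num.real).
Let w := \sum_(a <- Phi) k a *: H a.

Lemma coroot_sum_cartan : w \in h.
Proof. by rewrite /w big_seq rpred_sum // => a aP; rewrite rpredZ ?coroot_cartan. Qed.

Lemma ev_coroot_sum_real b : b \in Phi -> ev b w \is Num.real.
Proof.
move=> bP; rewrite linear_sum big_seq rpred_sum // => a aP.
by rewrite linearZ rpredM ?kR ?ev_coroot_real.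
Qed.

(** B(w, w) is the sum of the squares of the b(w), which are real. *)
Lemma coroot_sum_ge0 : 0 <= killing w w.
Proof.
rewrite killing_cartan ?coroot_sum_cartan // big_seq sumr_ge0 // => b bP.
by rewrite -expr2 real_exprn_even_ge0 // ev_coroot_sum_real.
Qed.

(** A vanishing sum of real squares makes every root vanish on w, and the roots have no common zero
    in h but 0. *)
Lemma coroot_sum_eq0 : killing w w = 0 -> w = 0.
Proof.
rewrite killing_cartan ?coroot_sum_cartan // => /eqP.
rewrite big_seq psumr_eq0 => [/allP w0|b bP]; last first.
  by rewrite -expr2 real_exprn_even_ge0 // ev_coroot_sum_real.
apply: cartan_eq0 coroot_sum_cartan _ => b bP.
by apply/eqP; have := w0 b bP; rewrite bP mulf_eq0 orbb.
Qed.

End RealSpan.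

(** If n(a, b) = 0 then b(H_a) = n(-a, b)^2 is nonnegative; for b = a the value is a sum of real
    squares. *)
Lemma addr_root a b : a \in Phi -> b \in Phi -> a + b != 0 -> ev b (H a) < 0 ->
  a + b \in Phi.
Proof.
move=> aP bP ab0; have [-> | ba] := eqVneq b a.
  rewrite ev_coroot ?coroot_cartan // killing_cartan ?coroot_cartan //.
  rewrite le_gtF // big_seq sumr_ge0 // => c cP.
  by rewrite -expr2 real_exprn_even_ge0 // ev_coroot_real.
have bNa : b != - a by rewrite -addr_eq0 addrC.
rewrite ev_coroot_string // -weyln_neq0 //; apply: contraTneq => ->.
by rewrite expr0n subr0 ltcE /= eqxx -leNgt sqr_ge0.
Qed.

(* Telescoping along the strings b + Z c: the sum is the trace of
   [X_c, X_(-c)] on the span of the X_b with P b. *)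
Lemma sum_ev_coroot_eq0 c (P : pred (dual h)) : c \in Phi ->
  (forall b, P (b + c) = P b) -> ~~ P 0 ->
  \sum_(b <- Phi | P b) ev b (H c) = 0.
Proof.
move=> cP Pc P0; have NcP := oppr_root cP.
have PcN b : P (b - c) = P b by rewrite -Pc subrK.
have nP a : a \in Phi -> \sum_(b <- Phi | P b) n a b ^+ 2 =
    \sum_(b <- [seq b <- Phi | P b & a + b \in Phi]) n a b ^+ 2.
  move=> aP; rewrite big_filter big_mkcondr /= big_seq_cond [RHS]big_seq_cond.
  apply: eq_bigr => b /andP[bP _]; rewrite -weyln_neq0 //.
  by case: eqP => //= ->; rewrite expr0n.
have -> : \sum_(b <- Phi | P b) ev b (H c) =
    (\sum_(b <- Phi | P b) n (- c) b ^+ 2 - \sum_(b <- Phi | P b) n c b ^+ 2)%:C%C.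
  rewrite -sumrB rmorph_sum /= big_seq_cond [RHS]big_seq_cond.
  apply: eq_bigr => b /andP[bP Pb]; apply: ev_coroot_string => //.
    (* By invariance of P under shifts by c, either of b = c and b = -c would make P hold at 0. *)
    by apply: contraNneq P0 => bc; rewrite -(subrr c) PcN -bc.
  by apply: contraNneq P0 => bc; rewrite -(addNr c) Pc -bc.
have [uPhi _] := Defs.rootsP F.
(* The shift b -> c + b carries the index set of the second sum onto that of the first, with equal
   terms by [weyln_shift]. *)
rewrite !nP // (perm_big [seq c + b | b <- Phi & P b && (c + b \in Phi)]) /=.
  rewrite big_map [X in X - _]big_seq [X in _ - X]big_seq.
  rewrite (eq_bigr (fun b => n c b ^+ 2)) ?subrr //.
  move=> b; rewrite mem_filter => /andP[/andP[_ cbP] bP].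
  by rewrite weyln_shift.
apply: uniq_perm; rewrite ?filter_uniq ?map_inj_uniq ?filter_uniq //.
  exact: addrI.
move=> b; rewrite mem_filter; apply/idP/mapP => [/andP[/andP[Pb cbP] bP]|].
  exists (- c + b); last by rewrite addNKr.
  by rewrite mem_filter addNKr bP cbP (addrC (- c)) PcN Pb.
case=> b'; rewrite mem_filter => /andP[/andP[Pb cbP] bP] ->.
by rewrite addKr cbP bP addrC Pc Pb.
Qed.

(** * t-roots, barycenters of coroots and the lifting of zero-sum triples *)

Local Notation tz := (tcenter F).
Local Notation kap := (@kappa R L F).

Lemma kappa_ev a (u : subvs_of tz) : kappa a u = ev a (vsval u).
Proof. by rewrite kappaE. Qed.

Lemma kappaD a b : kap (a + b) = kap a + kap b.
Proof. by apply/lfunP => u; rewrite add_lfunE !kappa_ev evD. Qed.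

Lemma kappaN a : kap (- a) = - kap a.
Proof. by apply/lfunP => u; rewrite opp_lfunE !kappa_ev evN. Qed.

Lemma kappa0 : kap 0 = 0.
Proof. by rewrite -(addNr 0) kappaD kappaN addNr. Qed.

Lemma mem_tcenter (v : realif L) :
  (v \in tz) = (v \in ihR F) && all (fun a => ev a v == 0) (roots_Theta F).
Proof.
rewrite memv_cap memv_bigcap_seq; congr (_ && _).
by apply: eq_all => a; rewrite memv_ker rootRE.
Qed.

Lemma kappa_Theta a : a \in roots_Theta F -> kap a = 0.
Proof.
move=> aP; apply/lfunP => u; rewrite kappa_ev zero_lfunE.
by have := subvsP u; rewrite mem_tcenter => /andP[_ /allP/(_ a aP)/eqP].
Qed.

Lemma roots_Theta_sub a : a \in roots_Theta F -> a \in Phi.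
Proof. by rewrite mem_filter => /andP[]. Qed.

Lemma mem_roots_M a : a \in Phi -> kap a != 0 -> a \in roots_M F.
Proof.
move=> aP a0; rewrite mem_filter aP andbT; apply: contraNN a0 => aT.
by rewrite kappa_Theta // mem_filter aT.
Qed.

Lemma troots_lift d : d \in troots F -> exists2 a, a \in Phi & kap a = d.
Proof.
rewrite mem_undup => /mapP[a + ->]; rewrite mem_filter => /andP[_ aP].
by exists a.
Qed.

Lemma ihR_sum (k : dual h -> R) :
  ('i%C *: \sum_(a <- Phi) (k a)%:C%C *: H a : realif L) \in ihR F.
Proof.
rewrite scaler_sumr big_seq rpred_sum // => a aP.
have -> : 'i%C *: ((k a)%:C%C *: H a) = k a *: ('i%C *: H a : realif L).
  by rewrite realif_scaleE !scalerA mulrC.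
by rewrite rpredZ // memv_span //; exact: map_f.
Qed.

Definition fiber_coef (d : troot F) a : R :=
  if kap a == d then (count (fun b => kap b == d) Phi)%:R^-1 else 0.

(* The barycenter of the coroots over a t-root, i.e. the orthogonal projection
   of each of them along the span of Theta. *)
Definition bary (d : troot F) : L := \sum_(a <- Phi) (fiber_coef d a)%:C%C *: H a.

Lemma bary_cartan d : bary d \in h.
Proof. exact: coroot_sum_cartan. Qed.

(** c restricts to 0 on t, so lying over d is invariant under shifts by c, and 0 does not lie over
    d; hence the sum of the a(H_c) telescopes to 0. *)
Lemma ev_bary_Theta d c : d != 0 -> c \in roots_Theta F -> ev c (bary d) = 0.
Proof.
move=> d0 cT; have cP := roots_Theta_sub cT.
transitivity ((count (fun b => kap b == d) Phi)%:R^-1%:C%C *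
    \sum_(a <- Phi | kap a == d) ev a (H c)).
  rewrite linear_sum mulr_sumr [RHS]big_mkcond; apply: eq_big_seq => a aP.
  rewrite linearZ /= /fiber_coef; case: ifP => _; last by rewrite scale0r.
  by rewrite ev_corootC.
rewrite sum_ev_coroot_eq0 ?mulr0 // => [b|]; last by rewrite kappa0 eq_sym.
by rewrite kappaD (kappa_Theta cT) addr0.
Qed.

Lemma ihR_cartan (v : realif L) : v \in ihR F -> (v : L) \in h.
Proof.
apply: (memv_span_ind (P := fun v : realif L => (v : L) \in h)).
- exact: mem0v.
- by move=> u w; exact: memvD.
move=> k _ /mapP[a aP ->]; rewrite realif_scaleE.
by rewrite !memvZ ?coroot_cartan.
Qed.

Lemma tcenter_cartan (v : realif L) : v \in tz -> (v : L) \in h.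
Proof. by rewrite mem_tcenter => /andP[/ihR_cartan]. Qed.

(** Every a over d gives B(u, H_a) = a(u) = d(u), and averaging keeps this value; thus [bary d]
    represents d on t. *)
Lemma killing_bary d (u : subvs_of tz) : d \in troots F ->
  killing (vsval u : L) (bary d) = d u.
Proof.
move=> /troots_lift[b bP bd]; have hu := tcenter_cartan (subvsP u).
have N0 : (count (fun b => kap b == d) Phi) != 0%N.
  by rewrite -lt0n -has_count; apply/hasP; exists b => //; rewrite bd.
transitivity (\sum_(a <- Phi | kap a == d)
    (count (fun b => kap b == d) Phi)%:R^-1%:C%C * (d u : R[i])).
  rewrite linear_sum [RHS]big_mkcond; apply: eq_big_seq => a aP.
  rewrite linearZ /= /fiber_coef; case: eqP => ad; last by rewrite scale0r.
  by rewrite -ev_coroot // -ad kappa_ev.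
rewrite big_const_seq iter_addr_0 -mulrnAl -rmorphMn /= -[_^-1 *+ _]mulr_natl.
by rewrite mulfV ?pnatr_eq0 // mul1r.
Qed.

Lemma bary_tcenter d : d != 0 -> ('i%C *: bary d : realif L) \in tz.
Proof.
move=> d0; rewrite mem_tcenter ihR_sum; apply/allP => c cT.
by rewrite linearZ /= ev_bary_Theta // scaler0.
Qed.

Lemma bary_neq0 d : d \in troots F -> d != 0 -> killing (bary d) (bary d) != 0.
Proof.
move=> dT; apply: contraNN => /eqP/coroot_sum_eq0 S0.
apply/eqP/lfunP => u; rewrite zero_lfunE -killing_bary //.
by rewrite [bary d]S0 ?linear0 // => a _; rewrite complex_real.
Qed.

(** Let s be the sum. Then i s lies in t, so B(i s, s) = (d + z + e)(i s) = 0, and definiteness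
    forces s = 0. *)
Lemma bary_triple (d z e : troot F) :
  zero_sum_triple d z e -> d != 0 -> z != 0 -> e != 0 ->
  bary d + bary z + bary e = 0.
Proof.
move=> [dT zT eT dze0] d0 z0 e0.
pose k a := (fiber_coef d a + fiber_coef z a + fiber_coef e a)%:C%C.
have sE : bary d + bary z + bary e = \sum_(a <- Phi) k a *: H a.
  by rewrite -!big_split; apply: eq_bigr => a _; rewrite /= -!scalerDl /k !rmorphD.
have Zs : ('i%C *: (bary d + bary z + bary e) : realif L) \in tz.
  by rewrite !scalerDr !memvD ?bary_tcenter.
pose u := vsproj tz ('i%C *: (bary d + bary z + bary e) : realif L).
have uE : vsval u = 'i%C *: (bary d + bary z + bary e) by exact: vsprojK.
have u0 : killing (vsval u : L) (bary d + bary z + bary e) = 0.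
  transitivity (d u + z u + e u : R[i]).
    by rewrite !killingDr; congr (_ + _ + _); exact: killing_bary.
  have := congr1 (fun f : troot F => f u) dze0.
  by rewrite !add_lfunE zero_lfunE.
rewrite sE; apply: coroot_sum_eq0 => [a _|]; first by rewrite complex_real.
move: u0; rewrite -sE uE killingZl => /eqP.
by rewrite mulf_eq0 complexiE (negPf (neq0Ci _)) /= => /eqP.
Qed.

Lemma killing_bary_real (d z : troot F) : killing (bary d) (bary z) \is Num.real.
Proof.
rewrite killing_cartan ?bary_cartan // big_seq rpred_sum // => a aP.
by rewrite rpredM ?ev_coroot_sum_real // => b _; rewrite complex_real.
Qed.

(** The product is a combination with nonnegative weights of the b(H_a) with a over d and b over z,
    so one of these is negative; d + z nonzero rules out a + b = 0. *)
Lemma killing_bary_lt0 (d z : troot F) : d + z != 0 -> killing (bary d) (bary z) < 0 ->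
  exists a b, [/\ a \in Phi, b \in Phi, a + b \in Phi, kap a = d & kap b = z].
Proof.
move=> dz0 neg.
case: (boolP (has (fun a => has (fun b =>
    [&& kap a == d, kap b == z & ev b (H a) < 0]) Phi) Phi)) => [|/hasPn nex].
  case/hasP => a aP /hasP[b bP /and3P[/eqP ad /eqP bz ab]].
  exists a, b; split => //; apply: addr_root => //.
  by apply: contraNneq dz0 => ab0; rewrite -ad -bz -kappaD ab0 kappa0.
suff : 0 <= killing (bary d) (bary z) by move/le_gtF; rewrite neg.
rewrite /bary killing_suml big_seq sumr_ge0 // => a aP.
rewrite killing_sumr big_seq sumr_ge0 // => b bP.
rewrite killingZl killingZr -ev_coroot ?coroot_cartan //.
have := nex a aP; rewrite -all_predC => /allP/(_ b bP) /=.
rewrite /fiber_coef; case: eqP => ad; last by rewrite mul0r.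
case: eqP => bz; last by rewrite mul0r mulr0.
move=> ge0; rewrite !mulr_ge0 ?lecR ?invr_ge0 //.
by rewrite real_leNgt ?ev_coroot_real ?rpred0.
Qed.

Lemma troot_triple_lift (d z e : troot F) :
  zero_sum_triple d z e -> d != 0 -> z != 0 -> e != 0 ->
  exists a b c, [/\ a \in Phi, b \in Phi, c \in Phi, a + b + c = 0
                & [/\ kap a = d, kap b = z & kap c = e]].
Proof.
move=> dze d0 z0 e0; have [dT zT eT dze0] := dze.
have dzE : d + z = - e by apply/eqP; rewrite -addr_eq0 dze0.
have deE : d + e = - z by apply/eqP; rewrite -addr_eq0 addrAC dze0.
have pos : 0 < killing (bary d) (bary d).
  rewrite lt_neqAle eq_sym bary_neq0 //=.
  by apply: coroot_sum_ge0 => a _; rewrite complex_real.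
(* The relation among the barycenters is paired with [bary d]. *)
have sum0 : killing (bary d) (bary d) + killing (bary d) (bary z) +
    killing (bary d) (bary e) = 0.
  by rewrite -!killingDr bary_triple // linear0.
have [dz|de] := addr3_eq0_lt0 pos (killing_bary_real d z) (killing_bary_real d e) sum0.
  have [|a [b [aP bP abP ad bz]]] := killing_bary_lt0 _ dz.
    by rewrite dzE oppr_eq0.
  exists a, b, (- (a + b)); rewrite oppr_root // subrr; split=> //; split=> //.
  by rewrite kappaN kappaD ad bz dzE opprK.
have [|a [c [aP cP acP ad ce]]] := killing_bary_lt0 _ de.
  by rewrite deE oppr_eq0.
exists a, (- (a + c)), c; rewrite oppr_root // opprD addNKr addNr; split=> //; split=> //.
by rewrite kappaD !kappaN ad ce -opprD deE opprK.
Qed.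

(** * The compact real form and the tangent space in terms of root vectors *)

Local Notation LR := (realif L).
Local Notation m := (subvs_of (tangent F)).

Lemma conjc_i : conjc ('i%C : R[i]) = - 'i%C.
Proof. by apply/eqP; rewrite eq_complex /= oppr0 !eqxx. Qed.

(** A real-linear parametrization of [u_ a] by the complex numbers, whose values at 1 and i are the
    two generators. *)
Definition uvec a (z : R[i]) : LR := z *: X a - conjc z *: X (- a).

Lemma mem_u_P a (v : LR) : reflect (exists z, v = uvec a z) (v \in u_ a).
Proof.
have uE (x y : R) : x *: (X a - X (- a) : LR) + y *: ('i%C *: (X a + X (- a)) : LR)
    = uvec a (x +i* y)%C.
  have zE : (x +i* y)%C = x%:C%C + y%:C%C * 'i%C.
    by apply/eqP; rewrite eq_complex /=; apply/andP; split; apply/eqP; ring.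
  have cE : conjc (x +i* y)%C = x%:C%C - y%:C%C * 'i%C.
    by apply/eqP; rewrite eq_complex /=; apply/andP; split; apply/eqP; ring.
  rewrite !realif_scaleE /uvec cE zE scalerA scalerBr scalerDr.
  by rewrite scalerDl scalerBl opprB addrACA [- _ + _]addrC.
rewrite /u_ span_cons span_seq1; apply: (iffP memv_addP).
  move=> [_ /vlineP[x ->] [_ /vlineP[y ->] ->]]; rewrite uE; by eexists.
case=> -[x y] ->; rewrite -uE.
exists (x *: (X a - X (- a) : LR)); first by apply: memvZ; exact: memv_line.
eexists; last by [].
by apply: memvZ; exact: memv_line.
Qed.

Lemma conjcNK (z : R[i]) : - conjc (- conjc z) = z.
Proof. by apply/eqP; case: z => x y; rewrite eq_complex /= !opprK !eqxx. Qed.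

(** Hence u_(-a) = u_a, and a root may be replaced by the positive one of a and -a. *)
Lemma uvec_opp a z : uvec (- a) z = uvec a (- conjc z).
Proof. by rewrite /uvec opprK rmorphN /= conjcK !scaleNr opprK addrC. Qed.

(** For a in R_M this puts X_a in the complex span of the tangent space, so complex-linear
    conditions can be tested on root vectors. *)
Lemma weyl_uvec a : X a = 2^-1 *: ((uvec a 1 : L) - 'i%C *: (uvec a 'i%C : L)).
Proof.
suff -> : (uvec a 1 : L) - 'i%C *: (uvec a 'i%C : L) = 2 *: X a.
  by rewrite scalerA mulVf ?scale1r // pnatr_eq0.
rewrite /uvec conjc1 conjc_i !scale1r scaleNr opprK scalerDr !scalerA -expr2 sqr_i.
by rewrite !scaleN1r opprD !opprK addrACA addNr addr0 -mulr2n -scaler_nat.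
Qed.

Lemma pos_or_opp a : a \in Phi -> pos_root (simples F) a || pos_root (simples F) (- a).
Proof.
have [freeS _ /[apply] -[c]] := simplesP F => /= aE.
have pos b : b = \sum_(i < size (simples F)) (simples F)`_i *+ c i ->
    pos_root (simples F) b.
  move=> ->; apply/forallP => i; rewrite linear_sum sumr_ge0 // => j _.
  rewrite linearMn /=.
  by rewrite (coord_free (X := in_tuple (simples F)) j i freeS) mulrn_wge0 // ler0n.
case: aE => aE; first by rewrite (pos a aE).
by rewrite (pos (- a)) ?orbT // aE opprK.
Qed.

(** If a = -b, the coordinates of a and b on the simple roots are nonnegative and add up to 0, so a
    = 0. *)
Lemma pos_root_add_neq0 a b : a \in Phi -> pos_root (simples F) a ->
  pos_root (simples F) b -> a + b != 0.
Proof.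
move=> + /forallP a_ge0 /forallP b_ge0; apply: contraTneq => ab0.
apply/negP => aP; have /negP[] := root_neq0 aP; apply/eqP.
have aS : a \in <<simples F>>%VS.
  have [_ _ /(_ a aP)[c /= aE]] := simplesP F.
  have bS : \sum_(i < size (simples F)) (simples F)`_i *+ c i \in <<simples F>>%VS.
    by rewrite rpred_sum // => i _; rewrite rpredMn // memv_span ?mem_nth.
  by case: aE => ->; rewrite ?rpredN.
rewrite (coord_span (X := in_tuple (simples F)) aS) big1 // => i _.
have : coord (in_tuple (simples F)) i a + coord (in_tuple (simples F)) i b = 0.
  by rewrite -linearD ab0 linear0.
move/eqP; rewrite paddr_eq0 // => /andP[/eqP-> _].
by rewrite scale0r.
Qed.

Lemma roots_M_sub a : a \in roots_M F -> a \in Phi.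
Proof. by rewrite mem_filter => /andP[]. Qed.

Lemma roots_M_opp a : a \in roots_M F -> - a \in roots_M F.
Proof.
by rewrite !mem_filter rpredN => /andP[-> /oppr_root].
Qed.

Lemma roots_M_posP a : a \in roots_M_pos F ->
  a \in roots_M F /\ pos_root (simples F) a.
Proof. by rewrite mem_filter => /andP[-> ->]. Qed.

Lemma roots_M_or_opp a : a \in roots_M F ->
  a \in roots_M_pos F \/ - a \in roots_M_pos F.
Proof.
move=> aM; rewrite !(mem_filter _ _ (roots_M F)) roots_M_opp // aM !andbT.
by apply/orP/pos_or_opp/roots_M_sub.
Qed.

Lemma uvec_tangent a z : a \in roots_M F -> uvec a z \in tangent F.
Proof.
case/roots_M_or_opp => aP; apply: memv_bigsum aP isT _; apply/mem_u_P.
  by exists z.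
by exists (- conjc z); rewrite uvec_opp conjcNK.
Qed.

(** The compact real form, split into isotropy algebra and tangent space; on it [mproj] will be
    compared with [projM]. *)
Definition uform := (kTheta F + tangent F)%VS.

Lemma uvec_uform a z : a \in Phi -> uvec a z \in uform.
Proof.
move=> aP; case: (boolP (a \in <<Theta F>>%VS)) => aT; last first.
  by apply/(subvP (addvSr _ _))/uvec_tangent; rewrite mem_filter aT.
apply/(subvP (addvSl _ _))/(subvP (addvSr _ _)).
case/orP: (pos_or_opp aP) => pos.
  apply: (@memv_bigsum _ _ _ _ _ _ a) => //; last by apply/mem_u_P; exists z.
  by rewrite !mem_filter pos aT.
apply: (@memv_bigsum _ _ _ _ _ _ (- a)) => //.
  by rewrite !mem_filter pos rpredN aT oppr_root.
by apply/mem_u_P; exists (- conjc z); rewrite uvec_opp conjcNK.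
Qed.

Lemma tangent_ind (P : LR -> Prop) : P 0 -> (forall u v, P u -> P v -> P (u + v)) ->
  (forall a z, a \in roots_M_pos F -> P (uvec a z)) ->
  forall v, v \in tangent F -> P v.
Proof.
move=> P0 PD PU; apply: memv_bigsum_ind => // a _ aP /mem_u_P[z ->].
exact: PU.
Qed.

Lemma ihR_coroot (x : R) a : a \in Phi -> ((x%:C%C * 'i%C) *: H a : LR) \in ihR F.
Proof.
move=> aP; rewrite -scalerA -[_ *: _]/(x *: ('i%C *: H a : LR)).
by rewrite memvZ // memv_span //; exact: map_f.
Qed.

Lemma lie_uvec a b z w : a \in Phi -> b \in Phi ->
  (lie (uvec a z : L) (uvec b w) : LR) \in uform.
Proof.
move=> aP bP; have [NaP NbP] := (oppr_root aP, oppr_root bP).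
(* Within a single u_c the bracket is an imaginary multiple of H_c, hence in i h_R. *)
have same c x y : c \in Phi -> (lie (uvec c x : L) (uvec c y) : LR) \in uform.
  move=> cP; have -> : lie (uvec c x : L) (uvec c y) =
      (conjc x * y - x * conjc y) *: H c.
    rewrite lieBl !lieBr !lieZl !lieZr !liexx !scaler0 sub0r subr0.
    rewrite (lieC (X (- c))) lie_weyl_opp // !scalerN opprK !scalerA.
    by rewrite addrC scalerBl.
  apply/(subvP (addvSl _ _))/(subvP (addvSl _ _)).
  have -> : conjc x * y - x * conjc y =
      (2 * complex.Im (conjc x * y))%:C%C * 'i%C.
    case: x y => [x1 x2] [y1 y2]; apply/eqP; rewrite eq_complex /=.
    by apply/andP; split; apply/eqP; ring.
  exact: ihR_coroot.
have [->|ba] := eqVneq b a; first exact: same.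
have [->|bNa] := eqVneq b (- a); first by rewrite uvec_opp; exact: same.
have ab0 : a + b != 0 by rewrite addrC addr_eq0.
have aNb0 : a - b != 0 by move: ba; apply: contra_neq => /subr0_eq.
(* If c + d is not a root, the coefficient n(c, d) vanishes and the vector is 0. *)
have sub c d x : c \in Phi -> d \in Phi -> c + d != 0 ->
    uvec (c + d) ((n c d)%:C%C * x) \in uform.
  move=> cP dP cd0; have [cdP|] := boolP (c + d \in Phi); first exact: uvec_uform.
  rewrite -weyln_neq0 // negbK => /eqP->.
  by rewrite mul0r /uvec conjc0 !scale0r subr0 mem0v.
(* The four brackets of root vectors pair up into two values of [uvec], because n is real and n(-a,
   -b) = -n(a, b). *)
suff -> : lie (uvec a z : L) (uvec b w) =
  (uvec (a + b) ((n a b)%:C%C * (z * w)) : L) -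
  uvec (a - b) ((n a (- b))%:C%C * (z * conjc w)).
  by apply: (@memvB _ LR); exact: sub.
have NaNb0 : - a - b != 0 by rewrite -opprD oppr_eq0.
have Nab0 : - a + b != 0 by rewrite -(opprK b) -opprD oppr_eq0.
rewrite lieBl !lieBr !lieZl !lieZr (lie_weyl2 aP bP ab0) (lie_weyl2 aP NbP aNb0).
rewrite (lie_weyl2 NaP bP Nab0) (lie_weyl2 NaP NbP NaNb0).
have -> : n (- a) b = - n a (- b) by rewrite -weyln_opp // opprK.
have conj_n (r : R) x y : conjc (r%:C%C * (x * y)) = r%:C%C * (conjc x * conjc y).
  case: x y => [x1 x2] [y1 y2]; apply/eqP; rewrite eq_complex /=.
  by apply/andP; split; apply/eqP; ring.
rewrite (weyln_opp aP bP) /uvec !conj_n conjcK !opprD !opprK !scalerA.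
rewrite [X in _ + X = _]addrC addrACA !rmorphN /= !mulrN !scaleNr opprK.
by congr (_ *: _ - _ *: _ + (- (_ *: _) + _ *: _)); exact: mulrC.
Qed.

Lemma lie_tangent (x y : LR) : x \in tangent F -> y \in tangent F ->
  (lie (x : L) (y : L) : LR) \in uform.
Proof.
move=> Tx Ty; elim/tangent_ind: Tx => [|u v Uu Uv|a z /roots_M_posP[/roots_M_sub aP _]].
- by rewrite lie0l mem0v.
- by rewrite lieDl; exact: memvD.
elim/tangent_ind: Ty => [|u v Uu Uv|b w /roots_M_posP[/roots_M_sub bP _]].
- by rewrite linear0 mem0v.
- by rewrite lieDr; exact: memvD.
exact: lie_uvec.
Qed.

(* The complex-linear extension of the projection onto the tangent space. *)
Definition projM (v : L) : L := \sum_(a <- roots_M F) killing v (X (- a)) *: X a.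

Lemma projMD u v : projM (u + v) = projM u + projM v.
Proof. by rewrite -big_split; apply: eq_bigr => a _; rewrite killingDl scalerDl. Qed.

Lemma projMZ k v : projM (k *: v) = k *: projM v.
Proof. by rewrite scaler_sumr; apply: eq_bigr => a _; rewrite killingZl scalerA. Qed.

Lemma projM0 : projM 0 = 0.
Proof. by have := projMZ 0 0; rewrite !scale0r. Qed.

Lemma projM_cartan t : t \in h -> projM t = 0.
Proof.
move=> ht; rewrite /projM big1_seq // => a /andP[_ /roots_M_opp/roots_M_sub aP].
by rewrite killing_cartan_weyl // scale0r.
Qed.

Lemma uniq_roots_M : uniq (roots_M F).
Proof. by apply: filter_uniq; have [] := Defs.rootsP F. Qed.

Lemma projM_weyl b : b \in Phi -> projM (X b) = (b \in roots_M F)%:R *: X b.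
Proof.
move=> bP; have [bM | bM] := boolP (b \in roots_M F).
  rewrite /projM (bigD1_seq b) ?uniq_roots_M //= killing_weyl_opp //.
  rewrite big1_seq ?addr0 // => a /andP[ab /roots_M_opp/roots_M_sub aP].
  by rewrite killing_weyl // subr_eq0 eq_sym (negPf ab) scale0r.
rewrite scale0r /projM big1_seq // => a /andP[_ aM].
rewrite killing_weyl ?subr_eq0 //; last exact/roots_M_sub/roots_M_opp.
by case: eqP bM => [->|_ _]; rewrite ?aM // scale0r.
Qed.

Lemma projM_lie a b : a \in roots_M F -> b \in roots_M F ->
  projM (lie (X a) (X b)) = ((a + b \in roots_M F)%:R * (n a b)%:C%C) *: X (a + b).
Proof.
(* For b = -a the bracket is H_a, which projects to 0, and the indicator is 0 too since 0 is no
   root. *)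
move=> /roots_M_sub aP /roots_M_sub bP; have [ab0 | ab0] := eqVneq (a + b) 0.
  have -> : b = - a by apply/eqP; rewrite -addr_eq0 addrC ab0.
  rewrite lie_weyl_opp // projM_cartan ?coroot_cartan // subrr.
  have -> : (0 \in roots_M F) = false.
    by apply/negP => /roots_M_sub/root_neq0; rewrite eqxx.
  by rewrite mul0r scale0r.
rewrite lie_weyl2 // projMZ mulrC -scalerA.
have [abP | abP] := boolP (a + b \in Phi); first by rewrite projM_weyl.
have /eqP-> : n a b == 0 by rewrite -[_ == 0]negbK weyln_neq0.
by rewrite !scale0r.
Qed.

Lemma projM_tangent (v : LR) : v \in tangent F -> projM v = v.
Proof.
elim/tangent_ind => [|u w|a z /roots_M_posP[aM _]]; first exact: projM0.
  by rewrite projMD => -> ->.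
rewrite /uvec -scaleNr projMD !projMZ !projM_weyl ?roots_M_opp ?aM ?scale1r //.
  exact/roots_M_sub/roots_M_opp.
exact: roots_M_sub.
Qed.

Lemma projM_kTheta (v : LR) : v \in kTheta F -> projM v = 0.
Proof.
case/memv_addP => t ht [w kw ->]; rewrite projMD.
rewrite projM_cartan ?ihR_cartan // add0r.
elim/memv_bigsum_ind: kw => [|x y|a _ + /mem_u_P[z ->]]; first exact: projM0.
  by rewrite projMD => -> ->; rewrite addr0.
rewrite mem_filter => /andP[_ aT].
have aP := roots_Theta_sub aT.
have aM : (a \in roots_M F) = false.
  by move: aT; rewrite !mem_filter => /andP[->].
have NaM : (- a \in roots_M F) = false.
  by apply: contraFF aM => /roots_M_opp; rewrite opprK.
rewrite /uvec -scaleNr projMD !projMZ !projM_weyl ?oppr_root // aM NaM.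
by rewrite !scale0r !scaler0 addr0.
Qed.

(** [projM] is the identity on the tangent space and 0 on k_Theta; this also shows that their sum is
    direct, as [daddv_pi] requires. *)
Lemma mproj_projM (v : LR) : v \in uform -> (vsval (mproj F v) : L) = projM v.
Proof.
move=> vU; rewrite /mproj vsprojK ?memv_pi //.
have dxu : (tangent F :&: kTheta F = 0)%VS.
  apply/eqP; rewrite -subv0; apply/subvP => x; rewrite memv_cap memv0.
  by case/andP=> xT xK; rewrite -(projM_tangent xT) projM_kTheta.
have vU' : v \in (tangent F + kTheta F)%VS by rewrite addvC.
rewrite -[in RHS](daddv_pi_add dxu vU') projMD.
rewrite projM_tangent ?memv_pi // projM_kTheta ?memv_pi //.
by rewrite addr0.
Qed.

(** * Complexified Nijenhuis tensor, metric and G1 condition *)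

Section G1.
Variables (g : m -> m -> R) (J : 'End(m)) (lam eps : troot F -> R).
Hypotheses (hg : invariant_metric g) (hlam : metric_coeffs g lam).
Variable JC : 'End(L).
Hypothesis (JCE : forall x : m, JC (vsval x : L) = vsval (J x)).
Hypothesis (JCX : forall a, a \in roots_M F ->
  JC (X a) = ('i%C * (eps (kap a))%:C%C) *: X a).
Hypothesis (epsP : forall d, d \in troots F -> eps d = 1 \/ eps d = -1).
Hypothesis (epsN : forall d, d \in troots F -> eps (- d) = - eps d).

(* nijC and metC extend the Nijenhuis tensor and g complex-linearly; G1C is the
   polarization of g(N(u,v),u). *)
Definition nijC (u v : L) : L :=
  - 2 *: (- projM (lie (JC u) (JC v)) + projM (lie u v)
          + JC (projM (lie u (JC v))) + JC (projM (lie (JC u) v))).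

Lemma nijenhuis_nijC x y :
  (vsval (nijenhuis J x y) : L) = nijC (vsval x) (vsval y).
Proof.
have brE (u v : m) : (vsval (mbracket u v) : L) = projM (lie (vsval u : L) (vsval v)).
  by apply: mproj_projM; apply: lie_tangent; exact: subvsP.
rewrite /nijenhuis linearZ /= realif_scaleE !linearD linearN /= -!JCE !brE -!JCE.
by rewrite /nijC rmorphN rmorph_nat !scalerDr scalerN.
Qed.

Definition metC (u v : L) : R[i] :=
  - \sum_(a <- roots_M F) (lam (kap a))%:C%C * (killing u (X (- a)) * killing v (X a)).

Lemma metCDl u u' v : metC (u + u') v = metC u v + metC u' v.
Proof.
rewrite -opprD -big_split; congr (- _); apply: eq_bigr => a _ /=.
by rewrite killingDl mulrDl mulrDr.
Qed.

Lemma metCDr u v v' : metC u (v + v') = metC u v + metC u v'.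
Proof.
rewrite -opprD -big_split; congr (- _); apply: eq_bigr => a _ /=.
by rewrite killingDl !mulrDr.
Qed.

Lemma metCZl k u v : metC (k *: u) v = k * metC u v.
Proof.
rewrite mulrN mulr_sumr; congr (- _); apply: eq_bigr => a _.
by rewrite killingZl -mulrA mulrCA.
Qed.

Lemma metCZr k u v : metC u (k *: v) = k * metC u v.
Proof.
rewrite mulrN mulr_sumr; congr (- _); apply: eq_bigr => a _.
by rewrite killingZl !(mulrCA _ k).
Qed.

Lemma kappa_troots a : a \in roots_M F -> kap a \in troots F.
Proof. by move=> aM; rewrite mem_undup map_f. Qed.

Lemma lam_kappaN a : a \in roots_M F -> lam (kap (- a)) = lam (kap a).
Proof. by case: hlam => _ lamN _ aM; rewrite kappaN lamN // kappa_troots. Qed.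

Lemma metC_weyll a v : a \in roots_M F ->
  metC (X a) v = - ((lam (kap a))%:C%C * killing (X a) v).
Proof.
move=> aM; rewrite /metC (bigD1_seq a) ?uniq_roots_M //=.
rewrite killing_weyl_opp ?roots_M_sub // mul1r killingC.
rewrite big1_seq ?addr0 // => b /andP[ba bM].
rewrite killing_weyl ?roots_M_sub ?roots_M_opp // subr_eq0 eq_sym (negPf ba).
by rewrite mul0r mulr0.
Qed.

Lemma metC_weylr u a : a \in roots_M F ->
  metC u (X a) = - ((lam (kap a))%:C%C * killing u (X a)).
Proof.
move=> aM; have NaM := roots_M_opp aM.
rewrite /metC (bigD1_seq (- a)) ?uniq_roots_M //=.
rewrite lam_kappaN // opprK killing_weyl_opp ?roots_M_sub // mulr1.
rewrite big1_seq ?addr0 // => b /andP[ba bM].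
rewrite killing_weyl ?roots_M_sub // addrC addr_eq0 (negPf ba).
by rewrite !mulr0.
Qed.

(** X_a and X_(-a) carry the same coefficient lambda, so the form is -lambda B on u_a. *)
Lemma metC_uvec a z v : a \in roots_M F ->
  metC (uvec a z) v = - ((lam (kap a))%:C%C * killing (uvec a z : L) v).
Proof.
move=> aM; rewrite /uvec -scaleNr metCDl !metCZl !metC_weyll ?roots_M_opp //.
rewrite lam_kappaN // killingDl !killingZl !mulrN -opprD mulrDr.
by rewrite [X in - (X + _)]mulrCA [X in - (_ + X)]mulrCA.
Qed.

Lemma killing_uvec a b z w : a \in roots_M_pos F -> b \in roots_M_pos F ->
  a != b -> killing (uvec a z : L) (uvec b w : L) = 0.
Proof.
move=> /roots_M_posP[/roots_M_sub aP ap] /roots_M_posP[/roots_M_sub bP bp] ab.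
have ab0 := pos_root_add_neq0 aP ap bp.
have aNb0 : a - b != 0 by move: ab; apply: contra_neq => /subr0_eq.
have Nab0 : - a + b != 0 by rewrite -(opprK b) -opprD oppr_eq0.
have NaNb0 : - a - b != 0 by rewrite -opprD oppr_eq0.
have [NaP NbP] := (oppr_root aP, oppr_root bP).
rewrite /uvec -!scaleNr killingDl !killingDr !killingZl !killingZr.
rewrite (killing_weyl_eq0 aP bP ab0) (killing_weyl_eq0 aP NbP aNb0).
rewrite (killing_weyl_eq0 NaP bP Nab0) (killing_weyl_eq0 NaP NbP NaNb0).
by rewrite !mulr0 !addr0.
Qed.

Lemma tangent_subvs_ind (P : m -> Prop) : P 0 ->
  (forall x y, P x -> P y -> P (x + y)) ->
  (forall a z (x : m), a \in roots_M_pos F -> vsval x = uvec a z -> P x) ->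
  forall x, P x.
Proof.
move=> P0 PD PU x; rewrite -[x]vsvalK.
apply: (proj2 (A := vsval x \in tangent F)).
elim/tangent_ind: (subvsP x) => [|u v [Tu Pu] [Tv Pv]|a z aP].
- by rewrite mem0v linear0.
- by rewrite memvD // linearD; split=> //; apply: PD.
have Ta : uvec a z \in tangent F.
  by apply: uvec_tangent; have [] := roots_M_posP aP.
by split=> //; apply: PU aP _; rewrite vsprojK.
Qed.

Lemma metricE x y : (g x y)%:C%C = metC (vsval x) (vsval y).
Proof.
have [gC gl _ _] := hg.
have gDl u v w : g (u + v) w = g u w + g v w.
  by rewrite -[u in LHS]scale1r gl mul1r.
have g0l w : g 0 w = 0 by apply: (addrI (g 0 w)); rewrite -gDl !addr0.
elim/tangent_subvs_ind: x => [|x x' IH IH'|a z x aP xE].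
- by rewrite g0l linear0 -(scale0r 0) metCZl mul0r.
- by rewrite gDl rmorphD /= IH IH' -metCDl.
elim/tangent_subvs_ind: y => [|y y' IH IH'|b w y bP yE].
- by rewrite gC g0l linear0 -(scale0r 0) metCZr mul0r.
- by rewrite gC gDl !(gC _ x) rmorphD /= IH IH' -metCDr.
have [[aM _] [bM _]] := (roots_M_posP aP, roots_M_posP bP).
rewrite xE metC_uvec // -xE.
(* The families concentrated at the t-roots of a and of b have sums x and y. *)
have [_ _ /(_ (fun d => if d == kap a then x else 0)
             (fun d => if d == kap b then y else 0))] := hlam.
have u_mem c k (v : m) d : c \in roots_M_pos F -> vsval v = uvec c k ->
    vsval (if d == kap c then v else 0) \in tangent_ d.
  move=> cP vE; case: eqP => [->|_]; last by rewrite linear0 mem0v.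
  apply: memv_bigsum cP _ _; first exact: eqxx.
  by apply/mem_u_P; exists k.
have sumE c (v : m) : c \in roots_M_pos F ->
    \sum_(d <- troots_pos F) (if d == kap c then v else 0) = v.
  move=> cP; rewrite (bigD1_seq (kap c)) ?undup_uniq ?mem_undup ?map_f //= eqxx.
  by rewrite big1 ?addr0 // => d /negPf ->.
rewrite !sumE // => -> => [|d _]; last first.
  by split; [exact: u_mem xE | exact: u_mem yE].
congr (- _); rewrite (bigD1_seq (kap a)) ?undup_uniq ?mem_undup ?map_f //= eqxx.
rewrite big1 ?addr0 => [|d /negPf da]; last by rewrite da killing0l mulr0.
(* For distinct t-roots the component of y at [kap a] is 0, and B(x, y) = 0 as a and b are distinct
   positive roots. *)
case: eqP => [//|ab]; rewrite yE xE killing_uvec //.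
  by congr (_ * _); exact: linear0.
by apply/eqP => ab'; apply: ab; rewrite ab'.
Qed.

(** The [uvec a z] and the X_a, with a in R_M, are complex combinations of each other. f is a plain
    function so that each slot of [G1C] qualifies. *)
Lemma lin_tangent_eq0 (f : L -> R[i]) :
  (forall u v, f (u + v) = f u + f v) -> (forall k u, f (k *: u) = k * f u) ->
  (forall x : LR, x \in tangent F -> f x = 0) <->
  {in roots_M F, forall a, f (X a) = 0}.
Proof.
move=> fD fZ; split=> [f0 a aM | f0 x].
  rewrite (weyl_uvec a) fZ fD -scaleN1r !fZ.
  by rewrite (f0 _ (uvec_tangent 1 aM)) (f0 _ (uvec_tangent 'i%C aM)) !mulr0 addr0 mulr0.
elim/tangent_ind => [|u v fu fv|a z /roots_M_posP[aM _]].
- by rewrite -(scale0r 0) fZ mul0r.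
- by rewrite fD fu fv addr0.
rewrite /uvec -scaleNr fD !fZ f0 // f0 ?roots_M_opp //.
by rewrite !mulr0 addr0.
Qed.

Lemma nijCDl u u' v : nijC (u + u') v = nijC u v + nijC u' v.
Proof.
rewrite -scalerDr; congr (_ *: _).
rewrite linearD !lieDl !projMD !linearD /=.
by rewrite [X in X + _ + _ = _]addrACA [X in X + _ = _]addrACA [LHS]addrACA.
Qed.

Lemma nijCDr u v v' : nijC u (v + v') = nijC u v + nijC u v'.
Proof.
rewrite -scalerDr; congr (_ *: _).
rewrite linearD /= !lieDr !projMD !linearD /=.
by rewrite [X in X + _ + _ = _]addrACA [X in X + _ = _]addrACA [LHS]addrACA.
Qed.

Lemma nijCZl k u v : nijC (k *: u) v = k *: nijC u v.
Proof.
rewrite /nijC [RHS]scalerA [k * _]mulrC -scalerA; congr (_ *: _).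
have JZ w : JC (k *: w) = k *: JC w by exact: linearZ.
by rewrite !(JZ, lieZl, projMZ) !scalerDr scalerN.
Qed.

Lemma nijCZr k u v : nijC u (k *: v) = k *: nijC u v.
Proof.
rewrite /nijC [RHS]scalerA [k * _]mulrC -scalerA; congr (_ *: _).
have JZ w : JC (k *: w) = k *: JC w by exact: linearZ.
by rewrite !(JZ, lieZr, projMZ) !scalerDr scalerN.
Qed.

Definition G1C (u v w : L) : R[i] := metC (nijC u v) w + metC (nijC w v) u.

(** Forwards, g(N(x + z, y), x + z) = 0 is expanded, and the vanishing passes from tangent vectors
    to root vectors one slot at a time. Backwards, the value at (x, y, x) is twice g(N(x, y), x). *)
Lemma G1_structureP :
  G1_structure g J <->
  {in roots_M F & &, forall a b c, G1C (X a) (X b) (X c) = 0}.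
Proof.
have D1 v w u u' : G1C (u + u') v w = G1C u v w + G1C u' v w.
  by rewrite /G1C nijCDl metCDl metCDr addrACA.
have Z1 v w k u : G1C (k *: u) v w = k * G1C u v w.
  by rewrite /G1C nijCZl metCZl metCZr mulrDr.
have D2 u w v v' : G1C u (v + v') w = G1C u v w + G1C u v' w.
  by rewrite /G1C !nijCDr !metCDl addrACA.
have Z2 u w k v : G1C u (k *: v) w = k * G1C u v w.
  by rewrite /G1C !nijCZr !metCZl mulrDr.
have D3 u v w w' : G1C u v (w + w') = G1C u v w + G1C u v w'.
  by rewrite /G1C nijCDl metCDl metCDr addrACA.
have Z3 u v k w : G1C u v (k *: w) = k * G1C u v w.
  by rewrite /G1C nijCZl metCZl metCZr mulrDr.
have gE (x y z : m) :
    (g (nijenhuis J x y) z)%:C%C = metC (nijC (vsval x) (vsval y)) (vsval z).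
  by rewrite metricE nijenhuis_nijC.
split=> [G1 a b c aM bM cM | G1 x y].
  have pol (x y z : LR) : x \in tangent F -> y \in tangent F -> z \in tangent F ->
      G1C x y z = 0.
    move=> Tx Ty Tz.
    have diag (u : LR) : u \in tangent F -> metC (nijC u y) u = 0.
      move=> Tu; have := gE (vsproj _ u) (vsproj _ y) (vsproj _ u).
      by rewrite G1 !vsprojK.
    have := diag (x + z) (memvD Tx Tz).
    by rewrite nijCDl metCDl !metCDr !diag // add0r addr0.
  move: c cM; apply/(lin_tangent_eq0 (D3 _ _) (Z3 _ _)) => z Tz.
  move: b bM; apply/(lin_tangent_eq0 (D2 _ _) (Z2 _ _)) => y Ty.
  move: a aM; apply/(lin_tangent_eq0 (D1 _ _) (Z1 _ _)) => x Tx.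
  exact: pol.
apply: complexI; rewrite gE.
have : G1C (vsval x) (vsval y) (vsval x) = 0.
  apply: ((lin_tangent_eq0 (D1 _ _) (Z1 _ _)).2 _ _ (subvsP x)) => a aM.
  apply: ((lin_tangent_eq0 (D2 _ _) (Z2 _ _)).2 _ _ (subvsP y)) => b bM.
  apply: ((lin_tangent_eq0 (D3 _ _) (Z3 _ _)).2 _ _ (subvsP x)) => c cM.
  exact: G1.
by rewrite /G1C -mulr2n => /eqP; rewrite mulrn_eq0 => /eqP.
Qed.

(** * Evaluation on root vectors and the criterion on triples *)

Lemma nijC_weyl a b : a \in roots_M F -> b \in roots_M F ->
  nijC (X a) (X b) = ((a + b \in roots_M F)%:R * (- 2 * n a b *
    (1 + eps (kap a) * eps (kap b)
     - eps (kap (a + b)) * (eps (kap a) + eps (kap b)))))%:C%C *: X (a + b).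
Proof.
move=> aM bM; have JZ k w : JC (k *: w) = k *: JC w by exact: linearZ.
rewrite /nijC !JCX // !(lieZl, lieZr, projMZ, JZ) projM_lie // !JZ.
have [abM | abM] := boolP (a + b \in roots_M F); last first.
  by rewrite !mul0r !(scale0r, scaler0) oppr0 !addr0 scaler0.
(* As i^2 = -1, the first term contributes e_a e_b, and the last two contribute -e_(a+b) e_b and
   -e_(a+b) e_a. *)
rewrite JCX // !scalerA -!scaleNr -!scalerDl scalerA; congr (_ *: _).
by apply/eqP; rewrite eq_complex /=; apply/andP; split; apply/eqP; ring.
Qed.

Lemma G1C_weyl a b c : a \in roots_M F -> b \in roots_M F -> c \in roots_M F ->
  G1C (X a) (X b) (X c) = ((a + b + c == 0)%:R * (2 * n a b *
    (1 + eps (kap a) * eps (kap b) + eps (kap b) * eps (kap c)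
       + eps (kap c) * eps (kap a)) * (lam (kap c) - lam (kap a))))%:C%C.
Proof.
move=> aM bM cM.
(* X_(x+y) pairs with X_z only if x + y + z = 0; then the sign of x + y is minus that of z, which
   makes the factor symmetric in the three signs. *)
have val x y z : x \in roots_M F -> y \in roots_M F -> z \in roots_M F ->
    metC (nijC (X x) (X y)) (X z) = ((x + y + z == 0)%:R * (2 * n x y *
    (1 + eps (kap x) * eps (kap y) + eps (kap y) * eps (kap z)
       + eps (kap z) * eps (kap x)) * lam (kap z)))%:C%C.
  move=> xM yM zM; rewrite nijC_weyl // metCZl metC_weylr //.
  have [xyM | xyM] := boolP (x + y \in roots_M F); last first.
    rewrite mul0r [LHS]mul0r; case: eqP => [xyz|]; last by rewrite mul0r.
    case/negP: xyM; have -> : x + y = - z by apply/eqP; rewrite -addr_eq0 xyz.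
    exact: roots_M_opp.
  rewrite killing_weyl ?roots_M_sub //; case: eqP => [xyz|_]; last first.
    by rewrite mulr0 oppr0 mulr0 mul0r.
  have -> : kap (x + y) = - kap z.
    by rewrite -kappaN; congr kap; apply/eqP; rewrite -addr_eq0 xyz.
  rewrite epsN ?kappa_troots //.
  by apply/eqP; rewrite eq_complex /=; apply/andP; split; apply/eqP; ring.
rewrite /G1C !val //.
have -> : c + b + a = a + b + c by rewrite addrC addrA addrAC.
case: eqP => [abc|_]; last by rewrite !mul0r addr0.
have [aP bP cP] := And3 (roots_M_sub aM) (roots_M_sub bM) (roots_M_sub cM).
(* n(c, b) = -n(b, c) = -n(a, b), so the second summand enters with a minus sign. *)
rewrite (weylnC bP cP) -(weyln_cycle aP bP cP abc).
by rewrite -rmorphD; congr (_%:C%C); ring.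
Qed.

Lemma G1C_eq0_iff :
  {in roots_M F & &, forall a b c, G1C (X a) (X b) (X c) = 0} <->
  (forall d z e : troot F, triple03 eps d z e -> lam d = lam z /\ lam z = lam e).
Proof.
split=> [G0 d z e [dze [dzE zeE]] | lamE a b c aM bM cM].
  have [dT zT eT _] := dze.
  (* The sign is odd and takes the values 1 and -1 on t-roots, so 0 is not a t-root. *)
  have nz x : x \in troots F -> x != 0.
    move=> xT; apply/eqP => x0; have := epsN xT; rewrite x0 oppr0 => /eqP.
    rewrite -addr_eq0 -mulr2n mulrn_eq0 /= -x0.
    by case: (epsP xT) => ->; rewrite ?oppr_eq0 oner_eq0.
  have [a [b [c [aP bP cP abc [ad bz ce]]]]] :=
    troot_triple_lift dze (nz d dT) (nz z zT) (nz e eT).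
  have [aM bM cM] : [/\ a \in roots_M F, b \in roots_M F & c \in roots_M F].
    by split; apply: mem_roots_M; rewrite ?ad ?bz ?ce ?nz.
  have eps2 : eps e * eps e = 1.
    by case: (epsP eT) => ->; rewrite ?mulrNN mulr1.
  (* For equal signs the factor is 4, and n(x, y) is nonzero, so the coefficients of the first and
     the last root agree. *)
  have E (x y w : dual h) : x \in roots_M F -> y \in roots_M F -> w \in roots_M F ->
      x + y + w = 0 -> eps (kap x) = eps e -> eps (kap y) = eps e ->
      eps (kap w) = eps e -> lam (kap x) = lam (kap w).
    move=> xM yM wM xyw xe ye we; have := G0 x y w xM yM wM.
    rewrite G1C_weyl // xyw eqxx xe ye we eps2 mul1r => /(congr1 (@complex.Re _)) /= /eqP.
    have nxy : n x y != 0.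
      rewrite weyln_neq0; [|exact: roots_M_sub|exact: roots_M_sub].
      have -> : x + y = - w by apply/eqP; rewrite -addr_eq0 xyw.
      by apply/oppr_root/roots_M_sub.
    have four_neq0 : (1 + 1 + 1 + 1 : R) != 0 by apply: lt0r_neq0; lra.
    rewrite !mulf_eq0 (negPf nxy) (negPf four_neq0) pnatr_eq0 /=.
    by rewrite subr_eq0 => /eqP.
  split.
    (* [E] compares the outer entries, so c goes to the middle. *)
    rewrite -ad -bz; apply: (E a c b) => //; rewrite ?ad ?bz ?ce ?dzE ?zeE //.
    by rewrite addrAC.
  rewrite -bz -ce; apply: (E b a c) => //; rewrite ?ad ?bz ?ce ?dzE ?zeE //.
  by rewrite (addrC b).
rewrite G1C_weyl //; case: eqP => [abc|_]; last by rewrite mul0r.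
have dze : zero_sum_triple (kap a) (kap b) (kap c).
  by split; rewrite ?kappa_troots // -!kappaD abc kappa0.
have [/andP[/eqP ab /eqP bc]|ne] :=
    boolP ((eps (kap a) == eps (kap b)) && (eps (kap b) == eps (kap c))).
  have [-> ->] := lamE _ _ _ (conj dze (conj ab bc)).
  by rewrite subrr !mulr0.
have [aT bT cT _] := dze.
(* Two signs agree and the third differs, so the factor is 1 + 1 - 1 - 1. *)
suff -> : 1 + eps (kap a) * eps (kap b) + eps (kap b) * eps (kap c)
    + eps (kap c) * eps (kap a) = 0 by rewrite mulr0 mul0r mulr0.
case: (epsP aT) (epsP bT) (epsP cT) ne => -> [] -> [] -> ne;
  ring || by rewrite !eqxx in ne.
Qed.
End G1.

End Roots.

Theorem lemma7p3 (R : realType) (L : lieAlgType R[i])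
    (hL : semisimple_lie L) (F : flag_data L)
    (g : subvs_of (tangent F) -> subvs_of (tangent F) -> R)
    (J : 'End(subvs_of (tangent F)))
    (lam eps : troot F -> R)
    (hg : invariant_metric g) (hlam : metric_coeffs g lam)
    (hJ : invariant_acs J) (heps : acs_signs J eps) :
  G1_structure g J <->
  (forall d z e : troot F, triple03 eps d z e -> lam d = lam z /\ lam z = lam e).
Proof.
have [epsP epsN [JC [JCE JCX]]] := heps.
apply: iff_trans (G1_structureP hL hg hlam JCE) _.
exact: (G1C_eq0_iff hL hlam JCX epsP epsN).
Qed.
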